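(* Let $d \geq 2$. There exists a continuous non-negative function $g$ on the unit sphere $S_d$ of $\mathbb{C}^d$, vanishing only at the point $e_1 = (1,0,\dots,0)$ and satisfying $\int_{S_d} \log(g)\, d\sigma_d > -\infty$, with the property that the only function $m \in H^\infty(B_d)$ with $|m^\star| \leq g$ almost everywhere with respect to $\sigma_d$ is the zero function.
   Context: $B_d$ is the open unit ball in $\mathbb{C}^d$, $S_d$ is its boundary (the unit sphere), and $\sigma_d$ is normalized Lebesgue (surface) measure on $S_d$. $H^\infty(B_d)$ is the space of bounded analytic functions on $B_d$. For $m \in H^\infty(B_d)$, $m^\star$ denotes the boundary function on $S_d$ given by the radial limits of $m$, which exist $\sigma_d$-almost everywhere. *)

(* Defs.v *)
From HB Require Import structures.
From mathcomp Require Import all_boot all_order all_algebra.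
From mathcomp Require Import complex.
From mathcomp Require Import all_classical all_reals all_analysis.
From mathcomp Require Import measurable_realfun.
Set Implicit Arguments.
Unset Strict Implicit.
Unset Printing Implicit Defensive.
Import Order.TTheory GRing.Theory Num.Theory.
Import numFieldNormedType.Exports.
Local Open Scope classical_set_scope.
Local Open Scope ring_scope.
Local Open Scope complex_scope.

(* The usual topology of the complex field, as a normed module over itself.   *)
(* ['rV[R[i]]_d] then gets the product topology and the structure of a normed *)
(* module over [R[i]], so that [differentiable] means complex Frechet         *)
(* differentiability; the norm [`|z|] of a vector is the (R[i]-valued) sup    *)
(* norm, whence the separate Euclidean norm [enorm] below.                    *)
HB.instance Definition _ (R : rcfType) := PseudoPointedMetric.copy R[i] R[i]^o.
HB.instance Definition _ (R : rcfType) := NormedModule.copy R[i] R[i]^o.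

Section image_measure.
Local Open Scope ereal_scope.
Context d1 d2 (T1 : measurableType d1) (T2 : measurableType d2) (R : realType).
Variables (m : {measure set T1 -> \bar R}) (f : T1 -> T2).
Hypothesis mf : measurable_fun setT f.

(* [pushforward], with the measurability of [f] as an argument so that the    *)
(* measure structure can be inferred.                                         *)
Definition image_measure of measurable_fun setT f : set T2 -> \bar R :=
  pushforward m f.

Let image0 : image_measure mf set0 = 0.
Proof. by rewrite /image_measure /pushforward preimage_set0 measure0. Qed.

Let image_ge0 A : 0 <= image_measure mf A.
Proof. exact: (measure_ge0 m). Qed.

Let image_sigma_additive : semi_sigma_additive (image_measure mf).
Proof.
move=> F mF tF mUF; rewrite /image_measure /pushforward preimage_bigcup.
apply: measure_semi_sigma_additive.
- by move=> k; rewrite -[X in measurable X]setTI; exact: mf.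
- apply/trivIsetP => /= i j _ _ ij; rewrite -preimage_setI.
  by move/trivIsetP : tF => /(_ _ _ _ _ ij) ->//; rewrite preimage_set0.
- by rewrite -preimage_bigcup -[X in measurable X]setTI; exact: mf.
Qed.

HB.instance Definition _ := isMeasure.Build _ _ _ (image_measure mf)
  image0 image_ge0 image_sigma_additive.

End image_measure.

(* The library declares no usable [SigmaFiniteMeasure] instance for [\x]. *)
Lemma sigma_finite_product d1 d2 (T1 : measurableType d1)
    (T2 : measurableType d2) (R : realType)
    (m1 : {sigma_finite_measure set T1 -> \bar R})
    (m2 : {sigma_finite_measure set T2 -> \bar R}) :
  sigma_finite setT (m1 \x m2)%E.
Proof.
have /sigma_finiteP[F [TF ndF Foo]] := sigma_finiteT m1.
have /sigma_finiteP[G [TG ndG Goo]] := sigma_finiteT m2.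
exists (fun n => F n `*` G n).
  rewrite -setXTT TF TG predeqE => -[x y]; split.
    move=> [/= [n _ Fnx] [k _ Gky]]; exists (maxn n k) => //; split.
    - by move: x Fnx; exact/subsetPset/ndF/leq_maxl.
    - by move: y Gky; exact/subsetPset/ndG/leq_maxr.
  by move=> [n _ []/= ? ?]; split; exists n.
move=> k; have [? ?] := Foo k; have [? ?] := Goo k.
split; first exact: measurableX.
by rewrite product_measure1E// lte_mul_pinfty// ge0_fin_numE.
Qed.

Section power_measure.
Local Open Scope ereal_scope.
Context d (T : measurableType d) (R : realType).

Definition tcons n (p : T * n.-tuple T) : n.+1.-tuple T :=
  [the n.+1.-tuple T of p.1 :: p.2].

Lemma measurable_tcons n : measurable_fun setT (@tcons n).
Proof. exact: (measurable_cons measurable_fst measurable_snd). Qed.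

Section step.
Variables (mu : {sigma_finite_measure set T -> \bar R}) (n : nat).
Variable nu : {sigma_finite_measure set (n.-tuple T) -> \bar R}.

Definition tcons_measure : set (n.+1.-tuple T) -> \bar R :=
  image_measure (mu \x nu) (@measurable_tcons n).

HB.instance Definition _ := Measure.on tcons_measure.

Let tcons_measure_sigma_finite : sigma_finite setT tcons_measure.
Proof.
have [H TH Hoo] := sigma_finite_product mu nu.
pose uncons (t : n.+1.-tuple T) : T * n.-tuple T := (thead t, [tuple of behead t]).
have unconsK : cancel (@tcons n) uncons.
  move=> [x t]; rewrite /uncons /tcons /=; congr (_, _).
  exact/val_inj.
have consK : cancel uncons (@tcons n).
  by move=> t; rewrite [in RHS](tuple_eta t); apply/val_inj.
have muncons : measurable_fun setT uncons.
  apply/measurable_fun_pairP; split => /=.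
    exact: measurable_tnth.
  exact: measurable_behead.
exists (fun k => uncons @^-1` (H k)).
  by rewrite -preimage_bigcup -TH preimage_setT.
move=> k; have [mHk Hkoo] := Hoo k; split.
  by rewrite -[X in measurable X]setTI; exact: muncons.
rewrite /tcons_measure /image_measure /pushforward -comp_preimage.
by rewrite (_ : uncons \o _ = id)//; apply/funext => p; exact: unconsK.
Qed.

HB.instance Definition _ := Measure_isSigmaFinite.Build _ _ _ tcons_measure
  tcons_measure_sigma_finite.

End step.

(* The n-fold product of [mu], on n-tuples. *)
Fixpoint power_measure (mu : {sigma_finite_measure set T -> \bar R}) (n : nat) :
    {sigma_finite_measure set (n.-tuple T) -> \bar R} :=
  match n with
  | 0 => dirac [tuple]
  | n'.+1 => tcons_measure mu (power_measure mu n')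
  end.

End power_measure.

Section lebesgue_measure2.
Context (R : realType).

Definition lebesgue_measure2 : set (measurableTypeR R * measurableTypeR R) -> \bar R :=
  (@lebesgue_measure R \x @lebesgue_measure R)%E.

HB.instance Definition _ := Measure.on lebesgue_measure2.
HB.instance Definition _ := Measure_isSigmaFinite.Build _ _ _ lebesgue_measure2
  (sigma_finite_product (@lebesgue_measure R) (@lebesgue_measure R)).

End lebesgue_measure2.
Arguments lebesgue_measure2 {R}.

Section complex_topology.
Context (R : realType).
Implicit Types x y : R[i].

Lemma complex_gt0 x : 0 < x -> 0 < complex.Re x /\ x = (complex.Re x)%:C.
Proof.
case: x => a b; rewrite ltcE/= => /andP[/eqP b0 a0]; split=> //.
by rewrite b0.
Qed.

Lemma norm_complex_lt x (e : R) :
  `|complex.Re x| < e / 2 -> `|complex.Im x| < e / 2 -> `|x| < e%:C.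
Proof.
move=> ae be; have e20 : 0 < e / 2 by exact: le_lt_trans ae.
rewrite normc_def ltcR -[ltRHS]gtr0_norm; last by rewrite (splitr e) addr_gt0.
rewrite -sqrtr_sqr ltr_sqrt ?exprn_gt0//; last by rewrite (splitr e) addr_gt0.
apply: (@lt_le_trans _ _ ((e / 2) ^+ 2 + (e / 2) ^+ 2)).
  by rewrite ltrD// -real_normK ?num_real// ltr_pXn2r// nnegrE// ltW.
by rewrite [in leRHS](splitr e) sqrrD lerD2r lerDl mulrn_wge0// mulr_ge0 ?ltW.
Qed.

Lemma norm_Re_le x : `|complex.Re x|%:C <= `|x|.
Proof. by rewrite normc_def lecR -sqrtr_sqr ler_wsqrtr// lerDl sqr_ge0. Qed.

Lemma norm_Im_le x : `|complex.Im x|%:C <= `|x|.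
Proof. by rewrite normc_def lecR -sqrtr_sqr ler_wsqrtr// lerDr sqr_ge0. Qed.

Lemma lip1_continuous (f : R[i] -> R) :
  (forall x y, `|f x - f y|%:C <= `|x - y|) -> continuous f.
Proof.
move=> f1 x; apply/(@cvgrPdist_lt _ _ _ (nbhs x)) => e e0; apply/nbhs_ballP; exists e%:C.
  by rewrite /= ltcR.
by move=> y; rewrite /ball/= => xye; rewrite -ltcR; exact: le_lt_trans xye.
Qed.

Lemma Re_continuous : continuous (@complex.Re R : R[i] -> R).
Proof. by apply: lip1_continuous => x y; rewrite -raddfB norm_Re_le. Qed.

Lemma Im_continuous : continuous (@complex.Im R : R[i] -> R).
Proof. by apply: lip1_continuous => x y; rewrite -raddfB norm_Im_le. Qed.

Lemma realC_continuous : continuous (fun a : R => a%:C).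
Proof.
move=> a; apply/(@cvgrPdist_lt _ _ _ (nbhs a)) => e /complex_gt0[e0 ->].
apply/nbhs_ballP; exists (complex.Re e) => // b; rewrite /ball/= => abe.
by rewrite -rmorphB normc_def/= expr0n addr0 sqrtr_sqr ltcR.
Qed.

End complex_topology.

Section complex_space.
Context (R : realType) (d : nat).

Definition enorm (z : 'rV[R[i]]_d) : R :=
  Num.sqrt (\sum_j (complex.Re (z ord0 j) ^+ 2 + complex.Im (z ord0 j) ^+ 2)).

Definition cball : set 'rV[R[i]]_d := [set z | enorm z < 1].

Definition csphere : set 'rV[R[i]]_d := [set z | enorm z = 1].

(* C^d with its Borel sigma-algebra. *)
Definition borelC := g_sigma_algebraType (@open 'rV[R[i]]_d).

Definition complex_of_tuple
    (t : d.-tuple (measurableTypeR R * measurableTypeR R)) : 'rV[R[i]]_d :=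
  \row_j ((tnth t j).1 +i* (tnth t j).2).

Lemma measurable_complex_of_tuple :
  measurable_fun setT (complex_of_tuple : _ -> borelC).
Proof.
apply: (@measurability _ _ _ borelC setT _ (@open 'rV[R[i]]_d)) => // _ [U oU <-]; rewrite setTI.
pose box (qn : d.-tuple (rat * rat) * nat)
    : set (d.-tuple (measurableTypeR R * measurableTypeR R)) :=
  [set t | forall j, `|(tnth t j).1 - ratr (tnth qn.1 j).1| < (qn.2.+1%:R)^-1 /\
                     `|(tnth t j).2 - ratr (tnth qn.1 j).2| < (qn.2.+1%:R)^-1].
have mbox qn : measurable (box qn).
  rewrite (_ : box qn = \bigcap_(j in [set: 'I_d])
      ((fun t => (tnth t j).1) @^-1` ball (ratr (tnth qn.1 j).1 : R) (qn.2.+1%:R)^-1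
       `&` (fun t => (tnth t j).2) @^-1`
          ball (ratr (tnth qn.1 j).2 : R) (qn.2.+1%:R)^-1)).
    apply: fin_bigcap_measurable => // j _; apply: measurableI.
      rewrite -[X in measurable X]setTI.
      apply: (measurableT_comp measurable_fst (measurable_tnth j)) => //.
      exact: measurable_ball.
    rewrite -[X in measurable X]setTI.
    apply: (measurableT_comp measurable_snd (measurable_tnth j)) => //.
    exact: measurable_ball.
  apply/seteqP; split => t.
    by move=> /= h j _; have [? ?] := h j; split; rewrite /ball/= distrC.
  by move=> h j; have [] := h j I; rewrite /ball/= !(distrC (ratr _)).
pose V := complex_of_tuple @^-1` U.
rewrite -/V (_ : V = \bigcup_qn (if `[< box qn `<=` V >] then box qn else set0)).
  apply: countable_bigcupT_measurable; first exact: countableP.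
  by move=> qn; case: ifPn.
apply/seteqP; split => [t Vt|t [qn _]]; last first.
  by case: ifPn => // /asboolP; exact.
have : nbhs (complex_of_tuple t) U by exact: open_nbhs_nbhs.
move=> /nbhs_ballP[e /= /complex_gt0[e0 ->] eU].
set e' := complex.Re e in e0 eU.
have [n n0] : exists n : nat, (n.+1%:R)^-1 < e' / 2 / 2.
  have e4 : 0 < e' / 2 / 2 by rewrite !divr_gt0.
  have [n _ /(_ n (leqnn n))] := near_infty_natSinv_lt (PosNum e4).
  by exists n.
have qP (x : R) : {q : rat | `|x - ratr q| < (n.+1%:R)^-1}.
  apply: cid; have /rat_in_itvoo[q] : x - (n.+1%:R)^-1 < x + (n.+1%:R)^-1.
    by rewrite ltrD2l gtrN// invr_gt0.
  rewrite in_itv/= => xq; exists q.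
  by rewrite distrC lter_distl.
exists ([tuple (sval (qP (tnth t j).1), sval (qP (tnth t j).2)) | j < d], n) => //.
rewrite ifT; last first.
  apply/asboolP => u ubox; apply: eU; split; first by rewrite ltcR.
  move=> i j; have [] := ubox j; rewrite !tnth_mktuple/= => u1 u2.
  rewrite !mxE /ball/=; apply: norm_complex_lt => /=.
    rewrite [ltRHS]splitr (le_lt_trans (ler_distD (ratr (sval (qP (tnth t j).1))) _ _))//.
    rewrite ltrD// ?(lt_trans _ n0)//; first exact: (svalP (qP _)).
    by rewrite distrC.
  rewrite [ltRHS]splitr (le_lt_trans (ler_distD (ratr (sval (qP (tnth t j).2))) _ _))//.
  rewrite ltrD// ?(lt_trans _ n0)//; first exact: (svalP (qP _)).
  by rewrite distrC.
by move=> j; rewrite !tnth_mktuple/=; split; exact: svalP (qP _).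
Qed.

Lemma enorm_continuous : continuous (enorm : 'rV[R[i]]_d -> R).
Proof.
move=> z; apply: (@continuous_comp _ _ _ (fun z : 'rV[R[i]]_d => \sum_j (complex.Re (z ord0 j) ^+ 2 + complex.Im (z ord0 j) ^+ 2)) Num.sqrt); last exact: sqrt_continuous.
have cj j : (fun z : 'rV[R[i]]_d => z ord0 j) @ z --> z ord0 j.
  exact: coord_continuous.
apply: (@cvg_big _ _ _ _ _ _ _ (nbhs z)) => [|j _]; first exact: add_continuous.
have cRe : (fun z : 'rV[R[i]]_d => complex.Re (z ord0 j)) @ z --> complex.Re (z ord0 j).
  exact: (continuous_comp (cj j) (@Re_continuous R _)).
have cIm : (fun z : 'rV[R[i]]_d => complex.Im (z ord0 j)) @ z --> complex.Im (z ord0 j).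
  exact: (continuous_comp (cj j) (@Im_continuous R _)).
by apply: (@cvgD _ _ _ (nbhs z)); apply: (@cvgM _ _ (nbhs z)).
Qed.

Lemma open_cball : open cball.
Proof.
rewrite (_ : cball = enorm @^-1` [set x | x < 1]); last by [].
by apply: open_comp => [z _|]; [exact: enorm_continuous|exact: open_lt].
Qed.

(* The value at the origin is the junk value [0], which is not in [csphere]. *)
Definition radial_proj (z : borelC) : borelC := ((enorm z)^-1)%:C *: z.

Lemma measurable_radial_proj : measurable_fun setT radial_proj.
Proof.
apply: (@measurability _ _ _ borelC setT _ (@open 'rV[R[i]]_d)) => // _ [U oU <-]; rewrite setTI.
have E0 : open [set z : 'rV[R[i]]_d | enorm z != 0].
  rewrite (_ : mkset _ = enorm @^-1` [set x | x != 0])//.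
  by apply: open_comp => [z _|]; [exact: enorm_continuous|exact: open_neq].
have rc (z : 'rV[R[i]]_d) : enorm z != 0 -> {for z, continuous (radial_proj : 'rV[R[i]]_d -> 'rV[R[i]]_d)}.
  move=> z0; rewrite /radial_proj.
  apply: (@cvgZ _ _ _ (nbhs z)); last exact: cvg_id.
  apply: (@continuous_comp _ _ _ (fun z : 'rV[R[i]]_d => (enorm z)^-1) (fun a => a%:C)); last exact: realC_continuous.
  apply: (@cvgV _ _ (nbhs z)) => //; exact: enorm_continuous.
have mS (W : set 'rV[R[i]]_d) : open W -> measurable (W : set borelC).
  by move=> oW; apply: sub_sigma_algebra.
rewrite -[X in measurable X](setUIDK _ ([set z : borelC | enorm z != 0])).
apply: measurableU.
  apply: mS; rewrite openE => z [/= Uz z0]; apply: filterI; last first.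
    exact: open_nbhs_nbhs.
  apply: rc => //; exact: open_nbhs_nbhs.
rewrite (_ : _ `\` _ = (if `[< U 0 >] then ~` [set z : borelC | enorm z != 0] else set0)).
  case: ifPn => _; last exact: measurable0.
  by apply: measurableC; exact: mS.
apply/seteqP; split => z.
  move=> [/= Uz /negP/negPn/eqP z0].
  move: Uz; rewrite /radial_proj z0 invr0 scale0r => U0.
  by rewrite asboolT//= z0 eqxx.
case: ifPn => // /asboolP U0 /= /negP/negPn/eqP z0; split; last by rewrite z0 eqxx.
by rewrite /radial_proj z0 invr0 scale0r.
Qed.

Lemma measurable_cball : measurable (cball : set borelC).
Proof. by apply: sub_sigma_algebra; exact: open_cball. Qed.

(* 2d-dimensional Lebesgue measure on C^d = R^(2d). *)
Definition lebesgue_measureC : set borelC -> \bar R :=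
  image_measure (power_measure lebesgue_measure2 d) measurable_complex_of_tuple.

HB.instance Definition _ := Measure.on lebesgue_measureC.

Definition cball_volume : R := fine (lebesgue_measureC cball).

Lemma cball_volumeV_ge0 : 0 <= cball_volume^-1.
Proof. by rewrite invr_ge0 fine_ge0// (measure_ge0 lebesgue_measureC). Qed.

(* Normalized surface measure, defined as usual by means of cones:            *)
(*   sigma A = |{r *: z : 0 < r < 1, z in A}| / |B_d|    (A in the sphere).    *)
(* It is a measure on the Borel sets of C^d that is carried by [csphere].     *)
Definition surface_measure : set borelC -> \bar R :=
  mscale (NngNum cball_volumeV_ge0)
    (image_measure (mrestr lebesgue_measureC measurable_cball)
                   measurable_radial_proj).

HB.instance Definition _ := Measure.on surface_measure.

Lemma surface_measureE A : surface_measure A =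
  (cball_volume^-1%:E * lebesgue_measureC (radial_proj @^-1` A `&` cball))%E.
Proof. by []. Qed.

Definition e1 : 'rV[R[i]]_d := \row_(j < d) (j == 0 :> nat)%:R.

Definition Hinfty (m : 'rV[R[i]]_d -> R[i]) : Prop :=
  (forall z, cball z -> differentiable m z) /\
  exists M : R, forall z, cball z -> `|m z| <= M%:C.

(* [mstar] is a representative of the boundary function of [m]: for almost    *)
(* every [z] of the sphere, [mstar z] is the radial limit of [m] at [z].      *)
Definition boundary_function (m mstar : 'rV[R[i]]_d -> R[i]) : Prop :=
  {ae surface_measure, forall z, csphere z ->
     m (r%:C *: (z : 'rV[R[i]]_d)) @[r --> (1 : R)^'-] --> mstar z}.

End complex_space.

(* Main.v *)
Require Import Defs.
From HB Require Import structures.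
From mathcomp Require Import all_boot all_order all_algebra.
From mathcomp Require Import complex.
From mathcomp Require Import all_classical all_reals all_analysis.
From mathcomp Require Import measurable_realfun.
From mathcomp Require Import ring lra.
Set Implicit Arguments.
Unset Strict Implicit.
Unset Printing Implicit Defensive.
Import Order.TTheory GRing.Theory Num.Theory.
Import numFieldNormedType.Exports.
Import ComplexField.Normc.
Local Open Scope classical_set_scope.
Local Open Scope ring_scope.
Local Open Scope complex_scope.

(** The function is [g z = decay (|1 - z_1|)] with [decay x = exp (- x ^ (-3/2))].

    Its logarithm is integrable because the cap where [|1 - z_1| <= e] has
    surface measure at most of order [e ^ 2] ([surface_cap_le],
    [neglog_integral]).

    Let [m] be bounded and analytic in the ball with boundary values at most [g].
    The bound first passes from the sphere to the ball: fixing all coordinates of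
    [z] but the second, one gets a disc whose boundary circle is in the sphere
    and on which [g] is constant, so that the maximum principle gives
    [|m z| <= g z] in the whole ball ([boundary_bound_in_ball]).  Two points need
    care.  Boundary values are radial limits in the ball, not in the disc, and
    exist only almost everywhere: the maximum principle is therefore applied to
    the dilated functions [m (r z)], which are analytic past the boundary, and
    the limit [r -> 1] is taken by dominated convergence ([circle_limit_le]).
    And almost every disc has to have almost all its boundary in the good set:
    this follows from Fubini's theorem and from the invariance of planar
    Lebesgue measure under rotations ([exists_good_circle]).

    Next, let [p] be a point of the ball and restrict [m] to the complex line
    through [p] and [e1].  The slice of the ball is a disc with [e1] on its
    boundary, which a multiple of [1 / (1 - z_1)] maps to a half plane [Re > A];
    there [m] becomes an analytic function bounded by [exp (- c |u| ^ (3/2))].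
    Its product with [exp (N u)] is still bounded, whatever [N], and has boundary
    values at most [exp (N A)] in modulus; so by the maximum principle
    [|m| <= exp (N (A - Re u))], and [m] vanishes on letting [N] tend to infinity
    ([decay_vanishing]).

    The maximum principle is used in the form of the mean value inequality
    [|f 0| <= mean of |f| over the unit circle], for [f] complex differentiable
    at each point of the closed disc ([mean_value_inequality]); moving the centre
    is left to Moebius maps.  As nothing is known of the continuity of the
    derivative, it rests on Goursat's theorem for rectangles ([goursat]). *)

(** * Moduli of complex numbers, in the real field *)

Section complex_norm.
Context {R : realType}.
Implicit Types (x y z : R[i]) (f : R[i] -> R[i]).

Lemma normc_triangle x y : normc (x + y) <= normc x + normc y.
Proof. exact: le_normcD. Qed.

Lemma normcNE x : normc (- x) = normc x.
Proof. exact: normcN. Qed.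

Lemma normc_ge0 x : 0 <= normc x.
Proof. by case: x => a b; exact: sqrtr_ge0. Qed.

Lemma normc_dist x y : normc (x - y) = normc (y - x).
Proof. by rewrite -normcNE opprB. Qed.

Lemma normc_sqr x : normc x ^+ 2 = complex.Re x ^+ 2 + complex.Im x ^+ 2.
Proof. by case: x => a b /=; rewrite sqr_sqrtr// addr_ge0// sqr_ge0. Qed.

Lemma Re_le_normc x : `|complex.Re x| <= normc x.
Proof. by rewrite -lecR; exact: norm_Re_le. Qed.

Lemma Im_le_normc x : `|complex.Im x| <= normc x.
Proof. by rewrite -lecR; exact: norm_Im_le. Qed.

Lemma normcR (a : R) : normc a%:C = `|a|.
Proof. by rewrite /= expr0n addr0 sqrtr_sqr. Qed.

Lemma normc_i : normc ('i : R[i]) = 1.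
Proof. by rewrite /= expr0n add0r expr1n sqrtr1. Qed.

Lemma normc_eq0 x : (normc x == 0) = (x == 0).
Proof. by apply/eqP/eqP => [/eq0_normc//|->]; exact: normc0. Qed.

Lemma normc_gt0 x : (0 < normc x) = (x != 0).
Proof. by rewrite lt_def normc_ge0 andbT normc_eq0. Qed.

Lemma normc_le_ReIm x : normc x <= `|complex.Re x| + `|complex.Im x|.
Proof.
rewrite {1}[x]complexE (le_trans (normc_triangle _ _))// normcM normc_i mul1r.
by rewrite !normcR.
Qed.

Lemma normc_lerB x y : normc x - normc y <= normc (x - y).
Proof. by rewrite lerBlDr -{1}(subrK y x) normc_triangle. Qed.

Lemma nbhs_normcP (x : R[i]) (P : set R[i]) :
  nbhs x P <-> exists2 e : R, 0 < e & forall y, normc (y - x) < e -> P y.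
Proof.
split=> [/nbhs_ballP[e /= /complex_gt0[e0 ->] eP]|[e e0 eP]].
  by exists (complex.Re e) => // y xy; apply: eP; rewrite /ball/= distrC ltcR.
apply/nbhs_ballP; exists e%:C; first by rewrite /= ltcR.
by move=> y; rewrite /ball/= distrC => xy; apply: eP; rewrite -ltcR.
Qed.

Lemma cvg_normcP {T : Type} {F : set_system T} {FF : Filter F} (f : T -> R[i]) l :
  f @ F --> l <-> forall e : R, 0 < e -> \forall t \near F, normc (f t - l) < e.
Proof.
split=> [fl e e0|fl P /nbhs_normcP[e e0 eP]].
  by apply: (fl [set y | normc (y - l) < e]); apply/nbhs_normcP; exists e.
by have := fl _ e0; rewrite /nbhs/=; apply: filterS => t; exact: eP.
Qed.

Lemma differentiable_normcP f w : differentiable f w ->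
  exists c, forall e : R, 0 < e -> exists2 r : R, 0 < r &
    forall z, normc (z - w) < r ->
      normc (f z - f w - c * (z - w)) <= e * normc (z - w).
Proof.
move=> /derivable1_diffP; rewrite /derivable => /cvg_ex[c fc].
exists c => e e0; move/cvg_normcP : fc => /(_ e e0).
move=> /nbhs_normcP[r r0 rP]; exists r => // z zr.
have [->|zw] := eqVneq z w; first by rewrite !subrr mulr0 subrr normc0 mulr0.
have zw0 : z - w != 0 by rewrite subr_eq0.
have := rP (z - w); rewrite subr0 => /(_ zr zw0).
rewrite /= [(_ *: 1)]mulr1 subrK => /ltW.
have nzw : 0 < normc (z - w) by rewrite normc_gt0.
rewrite -(ler_pM2r nzw) -normcM; apply: le_trans.
rewrite le_eqVlt; apply/orP; left; apply/eqP; congr normc.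
by rewrite [X in X - c]/(_ *: _)/= mulrBl mulrAC mulVf// mul1r.
Qed.

End complex_norm.

(** * Goursat's theorem on rectangles *)

Section goursat.
Context {R : realType}.
Notation mu := (@lebesgue_measure R).
Implicit Types (F : R[i] -> R[i]) (f g : R -> R) (a b c d : R).

Lemma fine_lebesgue_itv a b : a <= b -> fine (mu `[a, b]%classic) = b - a.
Proof.
move=> ab; rewrite lebesgue_measure_itv/= lte_fin.
by case: ltP => //= ba; apply/esym/eqP; rewrite subr_eq0 eq_le ab ba.
Qed.

Lemma continuous_on_itv_integrable f a b :
  (forall x, a <= x <= b -> {for x, continuous f}) ->
  mu.-integrable `[a, b] (EFin \o f).
Proof.
move=> fc; apply: continuous_compact_integrable; first exact: segment_compact.
apply: continuous_in_subspaceT => x; rewrite inE/= in_itv/=; exact: fc.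
Qed.

Lemma Rintegral_split f a e b : a <= e -> e <= b ->
  (forall x, a <= x <= b -> {for x, continuous f}) ->
  \int[mu]_(x in `[a, b]) f x =
  \int[mu]_(x in `[a, e]) f x + \int[mu]_(x in `[e, b]) f x.
Proof.
move=> ae eb fc; have fi := continuous_on_itv_integrable fc.
apply/eqP; rewrite addrC -subr_eq; apply/eqP.
rewrite Rintegral_itvB ?bnd_simp// Rintegral_itv_obnd_cbnd//.
by apply: integrableS fi => //; apply: subset_itvr; rewrite bnd_simp.
Qed.

Lemma Rintegral_le_cst f a b (M : R) : a <= b ->
  (forall x, a <= x <= b -> {for x, continuous f}) ->
  (forall x, a <= x <= b -> `|f x| <= M) ->
  `|\int[mu]_(x in `[a, b]) f x| <= M * (b - a).
Proof.
move=> ab fc fM; have fi := continuous_on_itv_integrable fc.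
apply: (le_trans (le_normr_Rintegral _ fi)) => //.
rewrite -(fine_lebesgue_itv ab) -Rintegral_cst//.
apply: le_Rintegral => //.
- apply: continuous_on_itv_integrable => x xab.
  by apply: (continuous_comp (fc x xab)); exact: norm_continuous.
- by apply: continuous_on_itv_integrable => x xab; exact: cvg_cst.
Qed.

Lemma horizontal_continuous c : continuous (fun x : R => x +i* c).
Proof.
move=> x; apply/cvg_normcP => e e0; near=> y.
rewrite /= subrr expr0n addr0 sqrtr_sqr.
by near: y; apply: cvgr_distC_lt => //; exact: cvg_id.
Unshelve. all: by end_near. Qed.

Lemma vertical_continuous a : continuous (fun y : R => a +i* y).
Proof.
move=> x; apply/cvg_normcP => e e0; near=> y.
rewrite /= subrr expr0n add0r sqrtr_sqr.
by near: y; apply: cvgr_distC_lt => //; exact: cvg_id.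
Unshelve. all: by end_near. Qed.

(** The real part of the integral of [F dw], counterclockwise around the
    rectangle [[a, b] x [c, d]]; the imaginary part is that of [-i F]. *)
Definition Re_contour F a b c d : R :=
  \int[mu]_(x in `[a, b]) (complex.Re (F (x +i* c)) - complex.Re (F (x +i* d))) +
  \int[mu]_(y in `[c, d]) (complex.Im (F (a +i* y)) - complex.Im (F (b +i* y))).

Section rectangle.
Variables (F : R[i] -> R[i]) (a b c d : R).
Hypothesis dF : forall x y, a <= x <= b -> c <= y <= d ->
  differentiable F (x +i* y).

Let cF x y (xab : a <= x <= b) (ycd : c <= y <= d) :
  {for x +i* y, continuous F} := differentiable_continuous (dF xab ycd).

Lemma continuous_Re_horizontal x y : a <= x <= b -> c <= y <= d ->
  {for x, continuous (fun x => complex.Re (F (x +i* y)))}.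
Proof.
move=> xab ycd; apply: (continuous_comp (f := fun x => F (x +i* y))).
  by apply: continuous_comp; [exact: horizontal_continuous|exact: cF].
exact: Re_continuous.
Qed.

Lemma continuous_Im_vertical x y : a <= x <= b -> c <= y <= d ->
  {for y, continuous (fun y => complex.Im (F (x +i* y)))}.
Proof.
move=> xab ycd; apply: (continuous_comp (f := fun y => F (x +i* y))).
  by apply: continuous_comp; [exact: vertical_continuous|exact: cF].
exact: Im_continuous.
Qed.

Let cH x y y' : a <= x <= b -> c <= y <= d -> c <= y' <= d ->
  {for x, continuous (fun x => complex.Re (F (x +i* y)) - complex.Re (F (x +i* y')))}.
Proof. by move=> *; apply: cvgB; exact: continuous_Re_horizontal. Qed.

Let cV x x' y : a <= x <= b -> a <= x' <= b -> c <= y <= d ->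
  {for y, continuous (fun y => complex.Im (F (x +i* y)) - complex.Im (F (x' +i* y)))}.
Proof. by move=> *; apply: cvgB; exact: continuous_Im_vertical. Qed.

Lemma Re_contour_split_x x1 x2 x3 y1 y2 :
  a <= x1 -> x1 <= x2 -> x2 <= x3 -> x3 <= b -> c <= y1 -> y1 <= y2 -> y2 <= d ->
  Re_contour F x1 x3 y1 y2 = Re_contour F x1 x2 y1 y2 + Re_contour F x2 x3 y1 y2.
Proof.
move=> ? ? ? ? ? ? ?; rewrite /Re_contour (@Rintegral_split _ _ x2)//; last first.
  by move=> x ?; apply: cH; lra.
rewrite -!addrA; congr (_ + _); rewrite addrCA; congr (_ + _).
rewrite -RintegralD//=; last 2 first.
- by apply: continuous_on_itv_integrable => y ?; apply: cV; lra.
- by apply: continuous_on_itv_integrable => y ?; apply: cV; lra.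
by apply: eq_Rintegral => y _; rewrite addrA subrK.
Qed.

Lemma Re_contour_split_y x1 x2 y1 y2 y3 :
  a <= x1 -> x1 <= x2 -> x2 <= b -> c <= y1 -> y1 <= y2 -> y2 <= y3 -> y3 <= d ->
  Re_contour F x1 x2 y1 y3 = Re_contour F x1 x2 y1 y2 + Re_contour F x1 x2 y2 y3.
Proof.
move=> ? ? ? ? ? ? ?; rewrite /Re_contour (@Rintegral_split _ y1 y2)//; last first.
  by move=> x ?; apply: cV; lra.
rewrite addrACA; congr (_ + _).
rewrite -RintegralD//=; last 2 first.
- by apply: continuous_on_itv_integrable => y ?; apply: cH; lra.
- by apply: continuous_on_itv_integrable => y ?; apply: cH; lra.
by apply: eq_Rintegral => y _; rewrite addrA subrK.
Qed.

(** Around a small rectangle the affine part of [F] contributes nothing, and the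
    differentiability remainder contributes at most its size times the
    perimeter. *)
Lemma Re_contour_small x y (e : R) : a <= x <= b -> c <= y <= d -> 0 < e ->
  exists2 r : R, 0 < r & forall x1 x2 y1 y2,
    a <= x1 -> x2 <= b -> c <= y1 -> y2 <= d ->
    x1 <= x <= x2 -> y1 <= y <= y2 -> (x2 - x1) + (y2 - y1) < r ->
    `|Re_contour F x1 x2 y1 y2| <= e * ((x2 - x1) + (y2 - y1)) ^+ 2.
Proof.
move=> xab ycd e0.
have [[p q] /(_ (e / 2))] := differentiable_normcP (dF xab ycd).
move=> /(_ (divr_gt0 e0 (ltr0n _ 2)))[r r0 rP]; exists r => //.
move=> x1 x2 y1 y2 ax1 x2b cy1 y2d xx yy sr.
set s := (x2 - x1) + (y2 - y1) in sr *.
have est u v : x1 <= u <= x2 -> y1 <= v <= y2 ->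
    let z := F (u +i* v) - F (x +i* y) - (p +i* q) * ((u - x) +i* (v - y)) in
    `|complex.Re z| <= e / 2 * s /\ `|complex.Im z| <= e / 2 * s.
  move=> hu hv z.
  have nz : normc ((u +i* v) - (x +i* y)) <= s.
    apply: (le_trans (normc_le_ReIm _)) => /=.
    have : `|u - x| <= x2 - x1 by rewrite ler_norml; lra.
    have : `|v - y| <= y2 - y1 by rewrite ler_norml; lra.
    by rewrite /s; lra.
  have zs : normc z <= e / 2 * s.
    apply: le_trans (rP (u +i* v) (le_lt_trans nz sr)) _.
    by rewrite ler_pM2l// divr_gt0.
  by split; [exact: le_trans (Re_le_normc _) zs|exact: le_trans (Im_le_normc _) zs].
have b1 : `|\int[mu]_(x in `[x1, x2])
    (complex.Re (F (x +i* y1)) - complex.Re (F (x +i* y2)) - q * (y2 - y1))|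
    <= (e * s) * (x2 - x1).
  apply: Rintegral_le_cst => [|u hu|u hu]; first by lra.
    by apply: cvgB; [apply: cH; lra|exact: cvg_cst].
  have [|+ _] := est u y1 hu; first by lra.
  have [|+ _] := est u y2 hu; first by lra.
  case: (F (u +i* y1)) => P1 Q1; case: (F (u +i* y2)) => P2 Q2.
  case: (F _) => P0 Q0 /=; rewrite !ler_norml; lra.
have b2 : `|\int[mu]_(y in `[y1, y2])
    (complex.Im (F (x1 +i* y)) - complex.Im (F (x2 +i* y)) + q * (x2 - x1))|
    <= (e * s) * (y2 - y1).
  apply: Rintegral_le_cst => [|v hv|v hv]; first by lra.
    by apply: cvgD; [apply: cV; lra|exact: cvg_cst].
  have [|_ +] := est x1 v _ hv; first by lra.
  have [|_ +] := est x2 v _ hv; first by lra.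
  case: (F (x1 +i* v)) => P1 Q1; case: (F (x2 +i* v)) => P2 Q2.
  case: (F _) => P0 Q0 /=; rewrite !ler_norml; lra.
rewrite RintegralB//= in b1; last 2 first.
- by apply: continuous_on_itv_integrable => u ?; apply: cH; lra.
- by apply: continuous_on_itv_integrable => u ?; exact: cst_continuous.
rewrite RintegralD//= in b2; last 2 first.
- by apply: continuous_on_itv_integrable => u ?; apply: cV; lra.
- by apply: continuous_on_itv_integrable => u ?; exact: cst_continuous.
move: b1 b2; rewrite !Rintegral_cst// !fine_lebesgue_itv; try lra.
rewrite /Re_contour; set I1 := Rintegral _ _ _; set I2 := Rintegral _ _ _ => h1 h2.
have -> : I1 + I2 = (I1 - q * (y2 - y1) * (x2 - x1)) + (I2 + q * (x2 - x1) * (y2 - y1)).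
  by ring.
apply: (le_trans (ler_normD _ _)); apply: (le_trans (lerD h1 h2)).
by rewrite /s le_eqVlt; apply/orP; left; apply/eqP; ring.
Qed.

End rectangle.
End goursat.

Section goursat_theorem.
Context {R : realType}.
Implicit Types (F f : R[i] -> R[i]) (a b c d : R).

Lemma nested_intervals (u v : nat -> R) :
  (forall n, u n <= u n.+1) -> (forall n, v n.+1 <= v n) ->
  (forall n, u n <= v n) -> exists x, forall n, u n <= x <= v n.
Proof.
move=> /nondecreasing_seqP du /nonincreasing_seqP dv uv.
have uvnm n m : u n <= v m.
  by apply: le_trans (du _ _ (leq_maxl n m)) (le_trans (uv _) (dv _ _ (leq_maxr n m))).
have hu : has_sup (range u).
  by split; [exists (u 0%N), 0%N|exists (v 0%N) => _ [n _ <-]].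
exists (sup (range u)) => n; apply/andP; split.
  by apply: ub_le_sup; [by case: hu|exists n].
by apply: ge_sup => [|_ [m _ <-]]; [case: hu|].
Qed.

(** Bisection: if a rectangle has an integral above [e] times its area in modulus,
    then so has one of its quarters.
    At the common point of the nested rectangles so obtained this contradicts
    [Re_contour_small], all of them having the shape of the initial one. *)
Theorem goursat F a b c d : a < b -> c < d ->
  (forall x y, a <= x <= b -> c <= y <= d -> differentiable F (x +i* y)) ->
  Re_contour F a b c d = 0.
Proof.
move=> ab cd dF; apply/eqP/negP => /negP J0.
pose X := b - a; pose Y := d - c.
have X0 : 0 < X by rewrite subr_gt0.
have Y0 : 0 < Y by rewrite subr_gt0.
have J1 : 0 < `|Re_contour F a b c d| by rewrite normr_gt0.
set J := `|_| in J1.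
(* half the mean density of the integral, so that the inequality is strict at
   the start *)
pose e := J / (2 * (X * Y)).
have e0 : 0 < e by rewrite divr_gt0// !mulr_gt0.
pose h n : R := 2^-1 ^+ n.
have h0 n : 0 < h n by rewrite exprn_gt0// invr_gt0.
have hS n : h n = 2 * h n.+1 by rewrite /h exprS mulrA divff// mul1r.
pose bad n (p : R * R) := [/\ a <= p.1, p.1 + X * h n <= b,
  c <= p.2, p.2 + Y * h n <= d &
  e * ((X * h n) * (Y * h n)) <
    `|Re_contour F p.1 (p.1 + X * h n) p.2 (p.2 + Y * h n)| ].
pose next n (p q : R * R) := [/\ bad n.+1 q,
  p.1 <= q.1, q.1 + X * h n.+1 <= p.1 + X * h n,
  p.2 <= q.2 & q.2 + Y * h n.+1 <= p.2 + Y * h n ].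
have step n p : bad n p -> exists q, next n p q.
  case: p => x y [] /=; rewrite /next /=.
  have k0 := h0 n.+1; rewrite hS.
  have Xk : X * (2 * h n.+1) = 2 * (X * h n.+1) by ring.
  have Yk : Y * (2 * h n.+1) = 2 * (Y * h n.+1) by ring.
  have Xk0 : 0 < X * h n.+1 by rewrite mulr_gt0.
  have Yk0 : 0 < Y * h n.+1 by rewrite mulr_gt0.
  rewrite /bad /= Xk Yk; move: (X * h n.+1) (Y * h n.+1) Xk0 Yk0 => l k l0 k0'.
  move=> ax xb cy yd.
  have [? ? ?] : [/\ a <= x + l, x + l <= b & x + l + l <= b] by split; lra.
  have [? ?] : x + l <= x + l + l /\ x <= x + l.
    by split; lra.
  have [? ? ?] : [/\ c <= y + k, y + k <= d & y + k + k <= d] by split; lra.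
  have [? ?] : y + k <= y + k + k /\ y <= y + k.
    by split; lra.
  rewrite (@Re_contour_split_x _ _ a b c d _ x (x + l))//; try lra.
  rewrite !(@Re_contour_split_y _ _ a b c d _ _ _ y (y + k) (y + 2 * k))//; try lra.
  have -> : x + 2 * l = x + l + l by ring.
  have -> : y + 2 * k = y + k + k by ring.
  set A1 := Re_contour _ _ _ _ _; set A2 := Re_contour _ _ _ _ _.
  set A3 := Re_contour _ _ _ _ _; set A4 := Re_contour _ _ _ _ _.
  have n1 := ler_normD (A1 + A2) (A3 + A4).
  have n2 := ler_normD A1 A2; have n3 := ler_normD A3 A4 => bd.
  have [h1|h1] := ltP (e * (l * k)) `|A1|.
    by exists (x, y); split=> //=; split.
  have [h2|h2] := ltP (e * (l * k)) `|A2|.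
    by exists (x, y + k); split=> //=; split.
  have [h3|h3] := ltP (e * (l * k)) `|A3|.
    by exists (x + l, y); split=> //=; split.
  have [h4|h4] := ltP (e * (l * k)) `|A4|.
    by exists (x + l, y + k); split=> //=; split.
  exfalso; move: bd n1 n2 n3 h1 h2 h3 h4; clear.
  by move: A1 A2 A3 A4 => A1 A2 A3 A4; lra.
pose s := fix s n := if n is m.+1 then xget (s m) (next m (s m)) else (a, c).
have bads n : bad n (s n).
  elim: n => [|n ih].
    split=> //=; rewrite /h expr0 !mulr1 /X /Y; [lra|lra|].
    rewrite !(addrC _ (_ - _)) !subrK -/J /e -/X -/Y.
    have -> : J / (2 * (X * Y)) * (X * Y) = J / 2 by field; rewrite !gt_eqF.
    by rewrite ltr_pdivrMr// ltr_pMr// ltr1n.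
  by have [q qP] := step _ _ ih; have /= [] := @xgetPex _ (s n) _ (ex_intro _ q qP).
have nexts n : next n (s n) (s n.+1).
  by have [q qP] := step _ _ (bads n); exact: (@xgetPex _ (s n) _ (ex_intro _ q qP)).
have [x xP] : exists x, forall n, (s n).1 <= x <= (s n).1 + X * h n.
  apply: nested_intervals => n; [by have [] := nexts n|by have [] := nexts n|].
  by rewrite lerDl mulr_ge0// ltW.
have [y yP] : exists y, forall n, (s n).2 <= y <= (s n).2 + Y * h n.
  apply: nested_intervals => n; [by have [] := nexts n|by have [] := nexts n|].
  by rewrite lerDl mulr_ge0// ltW.
have xab : a <= x <= b.
  by have := xP 0%N; have [] := bads 0%N => ? ? _ _ _; lra.
have ycd : c <= y <= d.
  by have := yP 0%N; have [] := bads 0%N => _ _ ? ? _; lra.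
have XY0 : 0 < X + Y by rewrite addr_gt0.
have e'0 : 0 < e * (X * Y) / (X + Y) ^+ 2
  by apply: divr_gt0; [do 2 apply: mulr_gt0 => //|exact: exprn_gt0].
have [r r0 rP] := Re_contour_small dF xab ycd e'0.
have [n nr] : exists n, (X + Y) * h n < r.
  have : (X + Y) * h n @[n --> \oo] --> (X + Y) * 0.
    by apply: cvgMr; apply: cvg_expr; rewrite ger0_norm ?invr_ge0// invf_lt1// ltr1n.
  rewrite mulr0 => /cvgrPdist_lt/(_ r r0)[n _ /(_ n (leqnn n))] /=.
  rewrite sub0r normrN => nr; exists n.
  exact: le_lt_trans (ler_norm _) nr.
have [b1 b2 b3 b4] := bads n; rewrite ltNge => /negP; apply.
apply: le_trans (rP _ _ _ _ b1 b2 b3 b4 (xP n) (yP n) _) _; first lra.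
rewrite le_eqVlt; apply/orP; left; apply/eqP.
by field; rewrite gt_eqF.
Qed.

End goursat_theorem.

(** * The complex exponential and the mean value inequality *)

Section complex_exponential.
Context {R : realType}.
Implicit Types (f : R[i] -> R[i]) (w z : R[i]).

Definition cexp w : R[i] :=
  (expR (complex.Re w) * cos (complex.Im w)) +i* (expR (complex.Re w) * sin (complex.Im w)).

Lemma cexpD w z : cexp (w + z) = cexp w * cexp z.
Proof.
case: w => a b; case: z => p q; rewrite /cexp /= expRD cosD sinD.
by apply/eqP; rewrite eq_complex /=; apply/andP; split; apply/eqP; ring.
Qed.

Lemma normc_cexp w : normc (cexp w) = expR (complex.Re w).
Proof.
rewrite /= !exprMn -mulrDr cos2Dsin2 mulr1 sqrtr_sqr ger0_norm// expR_ge0.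
Qed.

Lemma cexp_periodic (x : R) : cexp (x +i* (2 * pi)) = cexp (x +i* 0).
Proof. by rewrite /cexp /= mulr_natl cos2pi sin2pi cos0 sin0. Qed.

Lemma is_derive_remainder (f : R -> R) (x l : R) : is_derive x 1 f l ->
  forall e : R, 0 < e -> exists2 r : R, 0 < r &
    forall h, `|h| < r -> `|f (h + x) - f x - l * h| <= e * `|h|.
Proof.
move=> [df fl] e e0.
have : h^-1 *: (f (h + x) - f x) @[h --> 0^'] --> l.
  rewrite -fl; move: df; rewrite /derivable /derive.
  by under eq_fun do rewrite /= [(_ *: 1)]mulr1.
move=> /cvgrPdist_le/(_ e e0)/nbhs_ballP[r /= r0 rP]; exists r => // h hr.
have [->|h0] := eqVneq h 0; first by rewrite add0r subrr mulr0 subrr normr0 mulr0.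
have := rP h; rewrite /ball/= sub0r normrN => /(_ hr h0).
have nh : 0 < `|h| by rewrite normr_gt0.
rewrite -(ler_pM2r nh) -normrM; apply: le_trans.
rewrite le_eqVlt; apply/orP; left; apply/eqP; rewrite distrC; congr (`|_|).
by rewrite mulrBl [_ *: _]mulrC mulrAC mulfK.
Qed.

Lemma differentiable_normc f w c :
  (forall e : R, 0 < e -> exists2 r : R, 0 < r & forall h, normc h < r ->
     normc (f (h + w) - f w - c * h) <= e * normc h) ->
  differentiable f w.
Proof.
move=> fc; apply/derivable1_diffP; apply/cvg_ex; exists c.
apply/cvg_normcP => e e0; have [r r0 rP] := fc _ (divr_gt0 e0 (ltr0n _ 2)).
apply/nbhs_normcP; exists r => // h; rewrite subr0 => hr h0.
rewrite /= [(_ *: 1)]mulr1.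
have nh : 0 < normc h by rewrite normc_gt0.
rewrite -(ltr_pM2r nh) -normcM.
apply: (@le_lt_trans _ _ (e / 2 * normc h)); last by rewrite ltr_pM2r//; lra.
apply: le_trans (rP h hr); rewrite le_eqVlt; apply/orP; left; apply/eqP.
by congr normc; rewrite mulrBl [_ *: _]mulrC mulrAC mulfK// mulrC.
Qed.

Lemma differentiable_cexp w : differentiable cexp w.
Proof.
apply: (@differentiable_normc _ _ (cexp w)) => e e0.
have w0 : 0 < normc (cexp w) by rewrite normc_cexp expR_gt0.
have [e' [e'0 e'1 ee]] : exists e' : R,
    [/\ 0 < e', e' <= 1 & 10 * e' * normc (cexp w) <= e].
  exists (Num.min 1 (e / normc (cexp w) / 10)); split.
  - by rewrite lt_min ltr01 !divr_gt0.
  - by rewrite ge_min lexx.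
  - have : Num.min 1 (e / normc (cexp w) / 10) <= e / normc (cexp w) / 10.
      by rewrite ge_min lexx orbT.
    by rewrite ler_pdivlMr// ler_pdivlMr// mulrAC (mulrC 10) mulrAC.
have [r1 r10 P1] := is_derive_remainder (is_derive_expR (0 : R)) e'0.
have [r2 r20 P2] := is_derive_remainder (is_derive_cos (0 : R)) e'0.
have [r3 r30 P3] := is_derive_remainder (is_derive_sin (0 : R)) e'0.
exists (Num.min e' (Num.min r1 (Num.min r2 r3))); first by rewrite !lt_min e'0 r10 r20.
move=> h; rewrite !lt_min => /and4P[he h1 h2 h3].
rewrite (addrC h) cexpD -[X in _ - X - _]mulr1 -mulrBr -mulrBr normcM mulrC.
apply: (@le_trans _ _ (10 * e' * normc h * normc (cexp w))); last first.
  by rewrite mulrAC ler_wpM2r// normc_ge0.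
rewrite ler_pM2r//.
have Rh := Re_le_normc h; have Ih := Im_le_normc h.
apply: (le_trans (normc_le_ReIm _)).
case: h Rh Ih he h1 h2 h3 => x y /=; set n := Num.sqrt _ => xn yn ne n1 n2 n3.
have := P1 x (le_lt_trans xn n1); have := P2 y (le_lt_trans yn n2).
have := P3 y (le_lt_trans yn n3).
rewrite !addr0 cos0 sin0 expR0 !subr0 mul1r oppr0 mul0r subr0 mul1r.
have := expR_gt0 x.
move: (expR x) (cos y) (sin y) => E C S E0 h3 h2 h1.
have x0 := normr_ge0 x; have y0 := normr_ge0 y.
have E1 : `|E - 1| <= 2 * n.
  have -> : E - 1 = (E - 1 - x) + x by ring.
  by rewrite (le_trans (ler_normD _ _))//; nra.
have E2 : E <= 3 by move: E1; rewrite ler_norml; lra.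
have -> : E * C - 1 - x = (E - 1 - x) + E * (C - 1) by ring.
have -> : E * S - y = E * (S - y) + (E - 1) * y by ring.
have k1 := ler_normD (E - 1 - x) (E * (C - 1)).
have k2 := ler_normD (E * (S - y)) ((E - 1) * y).
rewrite !normrM (gtr0_norm E0) in k1 k2.
have l5 : e' * `|y| <= e' * n by rewrite ler_wpM2l// ltW.
have l1 : E * `|C - 1| <= 3 * (e' * n).
  by apply: ler_pM => //; [exact: ltW|exact: le_trans h2 l5].
have l2 : E * `|S - y| <= 3 * (e' * n).
  by apply: ler_pM => //; [exact: ltW|exact: le_trans h3 l5].
have l3 : `|E - 1| * `|y| <= (2 * e') * n.
  by apply: ler_pM => //; apply: le_trans E1 _; rewrite ler_pM2l// ltW.
have l4 : e' * `|x| <= e' * n by rewrite ler_wpM2l// ltW.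
have l6 : 0 <= e' * n by apply: mulr_ge0; [exact: ltW|exact: le_trans xn].
by move: h1 k1 k2 l1 l2 l3 l4 l6; clear; lra.
Qed.

End complex_exponential.

Section mean_value.
Context {R : realType}.
Notation mu := (@lebesgue_measure R).
Implicit Types (f : R[i] -> R[i]).

Definition cis (y : R) : R[i] := cexp (0 +i* y).

Lemma normc_cis y : normc (cis y) = 1.
Proof. by rewrite normc_cexp expR0. Qed.

Lemma continuous_cis : continuous cis.
Proof.
move=> y; apply: (continuous_comp (@vertical_continuous _ 0 y)).
exact/differentiable_continuous/differentiable_cexp.
Qed.

Lemma normc_continuous : continuous (@normc R : R[i] -> R).
Proof.
move=> x; apply/(@cvgrPdist_lt _ _ _ (nbhs x)) => e e0; apply/nbhs_normcP; exists e => // y.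
move=> yx; apply: le_lt_trans yx; rewrite ler_norml.
by have := normc_lerB x y; have := normc_lerB y x; rewrite (normc_dist x y); lra.
Qed.

(** Pulled back by the exponential, circles around [0] become vertical segments
    of length [2 pi]; by periodicity the horizontal sides of the rectangle
    between two of them cancel, so that Goursat's theorem makes the circular
    means of [f] independent of the radius. *)
Theorem mean_value_inequality f :
  (forall z, normc z <= 1 -> differentiable f z) ->
  normc (f 0) * (2 * pi) <= \int[mu]_(y in `[0, 2 * pi]) normc (f (cis y)).
Proof.
move=> df; have p0 : 0 < 2 * pi :> R by rewrite mulr_gt0// pi_gt0.
have [->|f0] := eqVneq (f 0) 0.
  by rewrite normc0 mul0r Rintegral_ge0// => *; exact: normc_ge0.
have N0 : 0 < normc (f 0) by rewrite normc_gt0.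
set N := normc (f 0) in N0 *.
(* a rotation of the values making the one at 0 equal to its modulus times i;
   the vertical sides contribute imaginary parts to Re_contour *)
have [k k1 kf] : exists2 k : R[i], normc k = 1 & complex.Im (k * f 0) = N.
  exists ('i * (f 0)^*%C * (N^-1)%:C).
    rewrite !normcM normc_i normcR mul1r.
    have -> : normc (f 0)^*%C = N by apply: complexI; have := normcJ (f 0).
    by rewrite gtr0_norm ?invr_gt0// divff// gt_eqF.
  have : N ^+ 2 = complex.Re (f 0) ^+ 2 + complex.Im (f 0) ^+ 2 by rewrite normc_sqr.
  case: (f 0) => a b /= h.
  transitivity (N^-1 * (a ^+ 2 + b ^+ 2)); first ring.
  by rewrite -h expr2 mulrA mulVf ?mul1r// gt_eqF.
pose F w := k * f (cexp w).
have dF (x y : R) : x <= 0 -> differentiable F (x +i* y).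
  move=> x0; apply: differentiableM; first exact: differentiable_cst.
  apply: differentiable_comp; first exact: differentiable_cexp.
  by apply: df; rewrite normc_cexp /= -expR0 ler_expR.
have cIm (x y : R) : x <= 0 -> {for y, continuous (fun t : R => complex.Im (F (x +i* t)))}.
  move=> x0; apply: (continuous_comp (f := fun t : R => F (x +i* t))); last exact: Im_continuous.
  apply: continuous_comp; [exact: vertical_continuous|].
  exact/differentiable_continuous/dF.
have iIm (x : R) : x <= 0 -> mu.-integrable `[0, 2 * pi] (EFin \o (fun y : R =>
    complex.Im (F (x +i* y)))).
  by move=> x0; apply: continuous_on_itv_integrable => y _; exact: cIm.
have IE a : a < 0 -> \int[mu]_(y in `[0, 2 * pi]) complex.Im (F (a +i* y)) =
                     \int[mu]_(y in `[0, 2 * pi]) complex.Im (F (0 +i* y)).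
  move=> a0; have := @goursat _ F a 0 0 (2 * pi) a0 p0.
  rewrite /Re_contour => G; apply/eqP; rewrite -subr_eq0 -RintegralB//; last 2 first.
  - exact/iIm/ltW.
  - exact: iIm.
  rewrite -[X in X == _]add0r -[X in X + _](_ : \int[mu]_(x in `[a, 0])
    (complex.Re (F (x +i* 0)) - complex.Re (F (x +i* (2 * pi)))) = 0).
    by rewrite G// => x y /andP[_ x0] _; exact: dF.
  under eq_Rintegral do rewrite /F cexp_periodic subrr.
  by rewrite Rintegral_cst// mul0r.
have le0 : \int[mu]_(y in `[0, 2 * pi]) complex.Im (F (0 +i* y)) <=
           \int[mu]_(y in `[0, 2 * pi]) normc (f (cis y)).
  apply: le_Rintegral => //; first exact: iIm.
    apply: continuous_on_itv_integrable => y _.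
    apply: (continuous_comp (f := fun y => f (cis y))); last exact: normc_continuous.
    apply: continuous_comp; first exact: continuous_cis.
    by apply: differentiable_continuous; apply: df; rewrite normc_cis.
  move=> y _; apply: le_trans (ler_norm _) _; apply: le_trans (Im_le_normc _) _.
  by rewrite /F normcM k1 mul1r.
apply: le_trans le0; apply/ler_addgt0Pl => e e0.
have e20 : 0 < e / (2 * pi) by rewrite divr_gt0.
have : {for 0, continuous f}.
  by apply: differentiable_continuous; apply: df; rewrite normc0.
move=> /cvg_normcP/(_ _ e20)/nbhs_normcP[r r0 rP].
pose a := Num.min (-1) (ln r - 1).
have a0 : a < 0 by rewrite /a gt_min; apply/orP; left; lra.
have ar : expR a < r.
  rewrite -[ltRHS](lnK r0) ltr_expR; apply: (@le_lt_trans _ _ (ln r - 1)); last lra.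
  by rewrite /a ge_min lexx orbT.
rewrite -(IE a a0).
have : `|\int[mu]_(y in `[0, 2 * pi]) (complex.Im (F (a +i* y)) - N)| <=
    e / (2 * pi) * (2 * pi - 0).
  apply: Rintegral_le_cst => [|y _|y _]; first exact: ltW.
    by apply: cvgB; [exact/cIm/ltW|exact: cvg_cst].
  rewrite -kf -raddfB /F -mulrBr; apply: le_trans (Im_le_normc _) _.
  by rewrite normcM k1 mul1r ltW// rP// subr0 normc_cexp.
rewrite RintegralB//; last 2 first.
- exact/iIm/ltW.
- by apply: continuous_on_itv_integrable => y _; exact: cvg_cst.
rewrite subr0 divfK ?gt_eqF// Rintegral_cst//.
rewrite (fine_lebesgue_itv (ltW p0)) subr0 ler_norml.
by move=> /andP[+ _]; lra.
Qed.

End mean_value.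

(** * Limits of the mean value inequality *)

Lemma ae_mono d (T : measurableType d) (R : realType)
    (mu : {measure set T -> \bar R}) (P Q : T -> Prop) :
  (forall x, P x -> Q x) -> {ae mu, forall x, P x} -> {ae mu, forall x, Q x}.
Proof. by move=> PQ; apply: negligibleS => x; apply: contra_not; exact: PQ. Qed.

Lemma ae_conj d (X : measurableType d) (R : realType)
    (nu : {measure set X -> \bar R}) (P Q : X -> Prop) :
  {ae nu, forall x, P x} -> {ae nu, forall x, Q x} -> {ae nu, forall x, P x /\ Q x}.
Proof.
move=> hP hQ; apply: negligibleS (negligibleU hP hQ) => x /= nPQ.
by have [Px|] := pselect (P x); [right => Qx; exact: nPQ|left].
Qed.

Lemma ae_neq (R : realType) (c : R) : {ae @lebesgue_measure R, forall y : R, y != c}.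
Proof.
exists [set c]; split; [exact: measurable_set1|exact: lebesgue_measure_set1|].
by move=> y /= /negP/negPn/eqP.
Qed.

Section circle_limit.
Context {R : realType}.
Notation mu := (@lebesgue_measure R).

(** The mean value inequality for the functions [f k] survives a limit in which
    the boundary values are only controlled almost everywhere:
    the excess of [normc (f k)] over [M] tends to [0] by dominated
    convergence. *)
Theorem circle_limit_le (f : nat -> R[i] -> R[i]) (M0 M L : R) :
  (forall k z, normc z <= 1 -> differentiable (f k) z) ->
  (forall k z, normc z <= 1 -> normc (f k z) <= M0) ->
  {ae mu, forall y : R, 0 < y < 2 * pi -> forall e : R, 0 < e ->
     \forall k \near \oo, normc (f k (cis y)) <= M + e} ->
  (fun k => normc (f k 0)) @ \oo --> L -> L <= M.
Proof.
move=> df fM0 fM fL; have p0 : 0 < 2 * pi :> R by rewrite mulr_gt0// pi_gt0.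
pose D : set R := `[0, 2 * pi]%classic.
have mD : measurable D by exact: measurable_itv.
have c1 k : continuous (fun y : R => normc (f k (cis y))).
  move=> y; apply: (continuous_comp (f := fun t => f k (cis t))); last exact: normc_continuous.
  apply: continuous_comp; first exact: continuous_cis.
  by apply: differentiable_continuous; apply: df; rewrite normc_cis.
pose u k : R -> R := (fun y => normc (f k (cis y)) - M) \max (cst 0).
have cu k : continuous (u k).
  move=> y; apply: continuous_max; last exact: cvg_cst.
  by apply: cvgB; [exact: c1|exact: cvg_cst].
have iu k : mu.-integrable D (EFin \o u k).
  by apply: continuous_on_itv_integrable => y _; exact: cu.
have mk k : normc (f k 0) * (2 * pi) <= M * (2 * pi) + \int[mu]_(y in D) u k y.
  apply: le_trans (mean_value_inequality (df k)) _.
  have -> : M * (2 * pi) = \int[mu]_(y in D) M.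
    by rewrite Rintegral_cst// fine_lebesgue_itv ?subr0// ltW.
  have iM : mu.-integrable D (EFin \o (fun=> M)).
    by apply: continuous_on_itv_integrable => y _; exact: cvg_cst.
  rewrite -RintegralD//; apply: le_Rintegral => //.
  - by apply: continuous_on_itv_integrable => y _; exact: c1.
  - apply: continuous_on_itv_integrable => y _.
    by apply: cvgD; [exact: cvg_cst|exact: cu].
  - by move=> y _; rewrite -lerBlDl le_max lexx.
have u0 : (fun k => \int[mu]_(y in D) u k y) @ \oo --> (0 : R).
  pose C := `|M0| + `|M|.
  have ae0 : {ae mu, forall y, D y -> (fun k => (u k y)%:E) @ \oo --> (0%E : \bar R)}.
    have fM' := ae_conj fM (ae_conj (ae_neq 0) (ae_neq (2 * pi))).
    apply: ae_mono fM' => y [yP [y0 y1]]; rewrite /D /= in_itv/= => /andP[y0' y1'].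
    have yI : 0 < y < 2 * pi by rewrite !lt_def y0 y0' (eq_sym (2 * pi)) y1 y1'.
    apply: cvg_EFin; first exact: nearW.
    apply/cvgrPdist_le => e e0; near=> k; rewrite sub0r normrN /u /=.
    rewrite ger0_norm ?le_max ?lexx ?orbT// ge_max (ltW e0) andbT lerBlDl.
    by near: k; exact: (yP yI).
  have aeC : {ae mu, forall y k, D y -> (`|(u k y)%:E| <= C%:E)%E}.
    apply: aeW => y k _; rewrite lee_fin /u /= ger0_norm ?le_max ?lexx ?orbT//.
    rewrite ge_max addr_ge0// andbT.
    have := fM0 k (cis y); rewrite normc_cis => /(_ (lexx _)) h.
    by rewrite lerD ?(le_trans h) ?ler_norm// -normrN ler_norm.
  have iC : mu.-integrable D (cst C%:E).
    by apply: (@continuous_on_itv_integrable _ (cst C)) => y _; exact: cvg_cst.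
  have [_ _] := @dominated_convergence _ _ R mu D mD (fun k => EFin \o u k)
    (cst 0%E) (cst C%:E) (fun k => measurable_int mu (iu k)) (measurable_cst _) ae0 iC aeC.
  by rewrite integral0 => /fine_cvg.
have l1 : (fun k => normc (f k 0) * (2 * pi)) @ \oo --> L * (2 * pi).
  by apply: cvgM; [exact: fL|exact: cvg_cst].
have l2 : (fun k => M * (2 * pi) + \int[mu]_(y in D) u k y) @ \oo --> M * (2 * pi).
  by rewrite -[X in _ --> X]addr0; apply: cvgD; [exact: cvg_cst|exact: u0].
by rewrite -(ler_pM2r p0); apply: (ler_cvg_to l1 l2); apply: nearW => k; exact: mk.
Unshelve. all: by end_near.
Qed.

End circle_limit.

(** * Shears and rotations of the plane preserve Lebesgue measure *)

Section lebesgue_invariance.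
Context {R : realType}.
Notation mu := (@lebesgue_measure R).
Notation T := (measurableTypeR R).
Notation mu2 := (@lebesgue_measure2 R).

Lemma lebesgue_measure_shift (c : R) (A : set T) : measurable A ->
  mu ((fun x => x + c) @^-1` A) = mu A.
Proof.
have mc : measurable_fun [set: T] (fun x : T => x + c : T).
  exact: measurable_funD.
move=> mA; rewrite (_ : mu (_ @^-1` A) = image_measure mu mc A)//.
apply/esym; apply: lebesgue_measure_unique => // _ [[a b] _ <-].
rewrite /image_measure /pushforward /=.
rewrite (_ : _ @^-1` _ = `]a - c, b - c]%classic); last first.
  by apply/seteqP; split => x /=; rewrite !in_itv/= ltrBlDr lerBrDr.
rewrite !lebesgue_measure_itv/= !lte_fin ltrD2r.
by case: ifPn => // _; rewrite -!EFinB; congr (_%:E); ring.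
Qed.

(** A shear translates each line parallel to its axis. *)
Lemma lebesgue_measure2_shear_y (s : R) (A : set (T * T)) : measurable A ->
  mu2 ((fun p => (p.1, p.2 + s * p.1)) @^-1` A) = mu2 A.
Proof.
move=> mA; apply: eq_integral => x _ /=.
rewrite -[RHS](lebesgue_measure_shift (s * x) (measurable_xsection x mA)).
by congr (mu _); apply/seteqP; split => y; rewrite /xsection /= !inE.
Qed.

Lemma lebesgue_measure2_swap (A : set (T * T)) : measurable A ->
  mu2 ((fun p => (p.2, p.1)) @^-1` A) = mu2 A.
Proof.
have ms : measurable_fun [set: T * T] (fun p : T * T => (p.2, p.1) : T * T).
  by apply/measurable_fun_pairP; split; [exact: measurable_snd|exact: measurable_fst].
move=> mA; rewrite (_ : mu2 (_ @^-1` A) = image_measure mu2 ms A)//; apply/esym.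
apply: product_measure_unique => // B C mB mC.
transitivity (mu2 (C `*` B)).
  by congr (mu2 _); apply/seteqP; split => -[x y] /= [].
by rewrite /lebesgue_measure2 product_measure1E// muleC.
Qed.

Lemma lebesgue_measure2_shear_x (s : R) (A : set (T * T)) : measurable A ->
  mu2 ((fun p => (p.1 + s * p.2, p.2)) @^-1` A) = mu2 A.
Proof.
have ms : measurable_fun [set: T * T] (fun p : T * T => (p.2, p.1) : T * T).
  by apply/measurable_fun_pairP; split; [exact: measurable_snd|exact: measurable_fst].
move=> mA; have mA' : measurable ((fun p : T * T => (p.2, p.1) : T * T) @^-1` A).
  by rewrite -[X in measurable X]setTI; exact: ms.
rewrite -(lebesgue_measure2_swap mA) -(lebesgue_measure2_shear_y s mA').
rewrite -(lebesgue_measure2_swap)//.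
rewrite -[X in measurable X]setTI.
have m1 := @measurable_fst _ _ T T; have m2 := @measurable_snd _ _ T T.
have : measurable_fun [set: T * T] (fun p : T * T => (p.1 + s * p.2, p.2) : T * T).
  apply/measurable_fun_pairP; split; last exact: measurable_snd.
  by apply: measurable_funD => //; exact: measurable_funM.
by apply.
Qed.

End lebesgue_invariance.

Section null_sections.
Local Open Scope ereal_scope.
Context d1 d2 (T1 : measurableType d1) (T2 : measurableType d2) (R : realType).
Variables (m1 : {sigma_finite_measure set T1 -> \bar R})
          (m2 : {sigma_finite_measure set T2 -> \bar R}).

Lemma ae_exists d (T : measurableType d) (mu : {measure set T -> \bar R})
    (P : T -> Prop) (D : set T) :
  {ae mu, forall x, P x} -> measurable D -> 0 < mu D -> exists2 x, D x & P x.
Proof.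
move=> [N [mN N0 PN]] mD D0; apply: contrapT => nP.
suff : mu D <= mu N by rewrite N0 leNgt D0.
apply: le_measure; rewrite ?inE// => x Dx; apply: PN => /= Px.
by apply: nP; exists x.
Qed.

Lemma product_measureE (A : set (T1 * T2)) : measurable A ->
  \int[m1]_x m2 (xsection A x) = \int[m2]_y m1 (ysection A y).
Proof.
move=> mA; have := indic_fubini_tonelli m1 m2 mA.
by rewrite indic_fubini_tonelli_FE// indic_fubini_tonelli_GE.
Qed.

Lemma null_xsection (A : set (T1 * T2)) : measurable A ->
  (m1 \x m2) A = 0 -> {ae m1, forall x, m2 (xsection A x) = 0}.
Proof.
move=> mA A0; have mf := measurable_fun_xsection m2 mA.
have [+ _] := ae_eq_integral_abs m1 measurableT mf; move=> /(_ _)[].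
  by rewrite -[RHS]A0; apply: eq_integral => x _; rewrite gee0_abs.
by move=> N [mN N0 sN]; exists N; split => // x nx; apply: sN => h; apply: nx; exact: h.
Qed.

Lemma null_ysection (A : set (T1 * T2)) : measurable A ->
  (m1 \x m2) A = 0 -> {ae m2, forall y, m1 (ysection A y) = 0}.
Proof.
move=> mA A0; have mf := measurable_fun_ysection m1 mA.
have [+ _] := ae_eq_integral_abs m2 measurableT mf; move=> /(_ _)[].
  rewrite -[RHS]A0 [RHS](product_measureE mA).
  by apply: eq_integral => x _; rewrite gee0_abs.
by move=> N [mN N0 sN]; exists N; split => // x nx; apply: sN => h; apply: nx; exact: h.
Qed.

Lemma ae_xsection0 (A : set (T1 * T2)) : measurable A ->
  (forall y, m1 (ysection A y) = 0) -> {ae m1, forall x, m2 (xsection A x) = 0}.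
Proof.
move=> mA A0; apply: null_xsection => //.
by rewrite [LHS](product_measureE mA) integral0_eq.
Qed.

End null_sections.

Section rotation.
Context {R : realType}.
Notation mu := (@lebesgue_measure R).
Notation T := (measurableTypeR R).
Notation mu2 := (@lebesgue_measure2 R).

(** Complex multiplication by [u]. *)
Definition rot (u p : R * R) : R * R :=
  (u.1 * p.1 - u.2 * p.2, u.2 * p.1 + u.1 * p.2).

Lemma measurable_lin2 (a b c d : R) : measurable_fun [set: T * T]
  (fun p : T * T => (a * p.1 + b * p.2, c * p.1 + d * p.2) : T * T).
Proof.
have m1 := @measurable_fst _ _ T T; have m2 := @measurable_snd _ _ T T.
apply/measurable_fun_pairP; split.
  by apply: (@measurable_funD _ _ R setT) => //; exact: measurable_funM.
by apply: (@measurable_funD _ _ R setT) => //; exact: measurable_funM.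
Qed.

(** A rotation other than the half turn is a product of three shears, and the
    half turn is the square of a quarter turn. *)
Lemma lebesgue_measure2_rot (u : R * R) (A : set (T * T)) :
  u.1 ^+ 2 + u.2 ^+ 2 = 1 -> measurable A -> mu2 (rot u @^-1` A) = mu2 A.
Proof.
have mx s (B : set (T * T)) : measurable B ->
    measurable ((fun p => (p.1 + s * p.2, p.2)) @^-1` B : set (T * T)).
  move=> mB; rewrite -[X in measurable X]setTI.
  rewrite (_ : (fun p => _) = (fun p : T * T => (1 * p.1 + s * p.2, 0 * p.1 + 1 * p.2) : T * T)).
    exact: measurable_lin2.
  by apply/funext => p; rewrite !mul1r mul0r add0r.
have my s (B : set (T * T)) : measurable B ->
    measurable ((fun p => (p.1, p.2 + s * p.1)) @^-1` B : set (T * T)).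
  move=> mB; rewrite -[X in measurable X]setTI.
  rewrite (_ : (fun p => _) = (fun p : T * T => (1 * p.1 + 0 * p.2, s * p.1 + 1 * p.2) : T * T)).
    exact: measurable_lin2.
  by apply/funext => p; rewrite !mul1r mul0r addr0 addrC.
have gen (v : R * R) (B : set (T * T)) : 1 + v.1 != 0 -> v.1 ^+ 2 + v.2 ^+ 2 = 1 ->
    measurable B -> mu2 (rot v @^-1` B) = mu2 B.
  case: v => c s /= c1 cs mB; pose t := - (s / (1 + c)).
  rewrite -(lebesgue_measure2_shear_x t mB).
  rewrite -(lebesgue_measure2_shear_y s (mx t _ mB)).
  rewrite -(lebesgue_measure2_shear_x t (my s _ (mx t _ mB))).
  have ts : 1 + s * t = c.
    have s2 : s ^+ 2 = (1 - c) * (1 + c) by move: cs => /(canRL (addKr _)) ->; ring.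
    by rewrite /t mulrN mulrA -expr2 s2 mulfK//; ring.
  congr (mu2 _); apply/funext => -[x y]; rewrite /preimage /mkset /rot /=; congr (B _).
  have tc : t * (1 + c) = - s by rewrite /t mulNr divfK.
  congr (_, _); last by rewrite -[in LHS]ts; ring.
  rewrite (_ : x + t * y + t * (y + s * (x + t * y)) =
    (1 + s * t) * x + t * (1 + (1 + s * t)) * y); last by ring.
  by rewrite ts tc mulNr.
case: (eqVneq (1 + u.1) 0) => [u1 uu mA|u1 uu mA]; last exact: gen.
have u1E : u.1 = -1 by apply/eqP; rewrite -addr_eq0 addrC u1.
have u2E : u.2 = 0.
  by apply/eqP; rewrite -sqrf_eq0; apply/eqP; move: uu; rewrite u1E; lra.
have i0 : 1 + (0, 1 : R).1 != 0 :> R by rewrite addr0 oner_eq0.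
have i1 : (0 : R) ^+ 2 + 1 ^+ 2 = 1 by rewrite expr0n expr1n add0r.
have mA' : measurable (rot (0, 1) @^-1` A : set (T * T)).
  rewrite -[X in measurable X]setTI.
  rewrite (_ : rot _ = (fun p : T * T => (0 * p.1 + (- 1) * p.2, 1 * p.1 + 0 * p.2) : T * T)).
    exact: measurable_lin2.
  by apply/funext => p; rewrite /rot /= mulN1r mul1r.
rewrite -(gen _ _ i0 i1 mA) -(gen _ _ i0 i1 mA').
congr (mu2 _); apply/funext => -[x y]; rewrite /preimage /mkset /rot /= u1E u2E; congr (A _).
by congr (_, _); ring.
Qed.

(** By Tonelli it suffices that each rotation separately preserves null sets. *)
Lemma ae_rot_null (phi : R -> R * R) (C : set (T * T)) :
  measurable_fun [set: T] (phi : T -> T * T) ->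
  (forall y, (phi y).1 ^+ 2 + (phi y).2 ^+ 2 = 1) ->
  measurable C -> mu2 C = 0%E ->
  {ae mu2, forall b, {ae mu, forall y, ~ C (rot (phi y) b)}}.
Proof.
move=> mphi phi1 mC C0.
have mr : measurable_fun [set: (T * T) * T]
    (fun p : (T * T) * T => rot (phi p.2) p.1 : T * T).
  have m1 : measurable_fun [set: (T * T) * T] (fun p : (T * T) * T => p.1.1 : T).
    exact: (measurableT_comp measurable_fst measurable_fst).
  have m2 : measurable_fun [set: (T * T) * T] (fun p : (T * T) * T => p.1.2 : T).
    exact: (measurableT_comp measurable_snd measurable_fst).
  have mp := measurableT_comp mphi (@measurable_snd _ _ (T * T)%type T).
  have m3 := measurableT_comp (@measurable_fst _ _ T T) mp.
  have m4 := measurableT_comp (@measurable_snd _ _ T T) mp.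
  apply/measurable_fun_pairP; split.
    by apply: (@measurable_funB _ _ R setT); exact: measurable_funM.
  by apply: (@measurable_funD _ _ R setT); exact: measurable_funM.
pose A : set ((T * T) * T) := (fun p => rot (phi p.2) p.1) @^-1` C.
have mA : measurable A by rewrite -[X in measurable X]setTI; exact: mr.
have A0 (y : T) : mu2 (ysection A y) = 0%E.
  rewrite -C0 -(lebesgue_measure2_rot (phi1 y) mC).
  by congr (mu2 _); apply/seteqP; split => b; rewrite /ysection /= inE.
apply: ae_mono (@ae_xsection0 _ _ _ _ _ mu2 mu A mA A0).
move=> b b0; exists (xsection A b); split; [exact: measurable_xsection|exact: b0|].
by move=> y /contrapT Cy; rewrite /xsection /= inE.
Qed.

End rotation.

(** * Boxes and coordinates *)

Section boxes.
Context {R : realType}.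
Notation mu := (@lebesgue_measure R).
Notation T := (measurableTypeR R).
Notation mu2 := (@lebesgue_measure2 R).

Definition rect (c : R * R) (r s : R) : set (T * T) :=
  `]c.1 - r, c.1 + r[%classic `*` `]c.2 - s, c.2 + s[%classic.

Definition square c r := rect c r r.

Lemma measurable_rect c r s : measurable (rect c r s).
Proof. by apply: measurableX; exact: measurable_itv. Qed.

Lemma measurable_square c r : measurable (square c r).
Proof. exact: measurable_rect. Qed.

Lemma rectP c r s p : rect c r s p <-> `|p.1 - c.1| < r /\ `|p.2 - c.2| < s.
Proof. by rewrite /rect /= !in_itv/= !ltr_distl; split. Qed.

Lemma squareP c r p : square c r p <-> `|p.1 - c.1| < r /\ `|p.2 - c.2| < r.
Proof. exact: rectP. Qed.

Lemma lebesgue_measure2_rect c r s : 0 < r -> 0 < s ->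
  mu2 (rect c r s) = (4 * r * s)%:E.
Proof.
move=> r0 s0; pose I (x y : R) : set R := `]x - y, x + y[%classic.
transitivity (mu (I c.1 r) * mu (I c.2 s))%E.
  by apply: product_measure1E; exact: measurable_itv.
rewrite /I !lebesgue_measure_itv/= !lte_fin !ifT; [|lra..].
by rewrite -!EFinB -EFinM; congr (_%:E); ring.
Qed.

Lemma lebesgue_measure2_square c r : 0 < r ->
  mu2 (square c r) = ((2 * r) ^+ 2)%:E.
Proof. by move=> r0; rewrite lebesgue_measure2_rect//; congr (_%:E); ring. Qed.

Definition tbox n (c : n.-tuple (R * R)) (r : R) : set (n.-tuple (T * T)) :=
  [set t | forall j, square (tnth c j) r (tnth t j)].

Lemma measurable_tbox n (c : n.-tuple (R * R)) r : measurable (tbox c r).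
Proof.
rewrite (_ : tbox c r = \bigcap_(j in [set: 'I_n]) ((fun t => tnth t j) @^-1` square (tnth c j) r)).
  apply: fin_bigcap_measurable => // j _; rewrite -[X in measurable X]setTI.
  by apply: measurable_tnth => //; exact: measurable_square.
by apply/seteqP; split => t h j; [move=> _|]; apply: h.
Qed.

Lemma tconsS n (p : (T * T) * n.-tuple (T * T)) j :
  tnth (tcons p) (lift ord0 j) = tnth p.2 j.
Proof. exact: tnthS. Qed.

Lemma tnth_behead_lift n (u : n.+1.-tuple (T * T)) j :
  tnth [tuple of behead u] j = tnth u (lift ord0 j).
Proof. by rewrite [u in RHS]tuple_eta tnthS. Qed.

Lemma power_measure_tbox n (c : n.-tuple (R * R)) r : 0 < r ->
  power_measure mu2 n (tbox c r) = (((2 * r) ^+ 2) ^+ n)%:E.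
Proof.
move=> r0; elim: n c => [|n ih] c.
  by rewrite expr0 /= diracE mem_set// => -[].
transitivity ((mu2 \x power_measure mu2 n)%E
    (square (thead c) r `*` tbox [tuple of behead c] r)).
  congr ((mu2 \x power_measure mu2 n)%E _); apply/seteqP; split => -[a t] /=.
    move=> h; split; first exact: h ord0.
    by move=> j; have := h (lift ord0 j); rewrite tconsS tnth_behead_lift.
  move=> [h1 h2] j; case: (unliftP ord0 j) => [k ->|->]; last exact: h1.
  by rewrite tconsS; have := h2 k; rewrite tnth_behead_lift.
transitivity (mu2 (square (thead c) r) * power_measure mu2 n (tbox [tuple of behead c] r))%E.
  by apply: product_measure1E; [exact: measurable_square|exact: measurable_tbox].
by rewrite lebesgue_measure2_square// ih -EFinM; congr (_%:E); exact/esym/exprS.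
Qed.

End boxes.

Section coordinates.
Context {R : realType} {n : nat}.
Notation mu := (@lebesgue_measure R).
Notation T := (measurableTypeR R).
Notation mu2 := (@lebesgue_measure2 R).
Notation V := (@lebesgue_measureC R n.+2).

(** The first two coordinates are the ones that the discs and the complex lines
    of the proof single out. *)
Definition vec3 (a b : R * R) (t : n.-tuple (R * R)) : 'rV[R[i]]_n.+2 :=
  complex_of_tuple (@tcons _ _ n.+1 (a, @tcons _ (T * T)%type n (b, t))).

Lemma vec3_0 a b t : vec3 a b t ord0 ord0 = a.1 +i* a.2.
Proof. by rewrite mxE. Qed.

Lemma vec3_1 a b t : vec3 a b t ord0 (lift ord0 ord0) = b.1 +i* b.2.
Proof. by rewrite mxE tconsS. Qed.

Lemma vec3_S a b t j :
  vec3 a b t ord0 (lift ord0 (lift ord0 j)) = (tnth t j).1 +i* (tnth t j).2.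
Proof. by rewrite mxE !tconsS. Qed.

Let cyl k (D : set (T * T)) (E : set (k.-tuple (T * T))) : set (k.+1.-tuple (T * T)) :=
  [set u | D (thead u) /\ E [tuple of behead u]].

Let measurable_cyl k (D : set (T * T)) (E : set (k.-tuple (T * T))) :
  measurable D -> measurable E -> measurable (cyl D E).
Proof.
move=> mD mE; apply: (measurableI ((fun u => tnth u ord0) @^-1` D)
    ((fun u : k.+1.-tuple (T * T) => [tuple of behead u]) @^-1` E)).
  by rewrite -[X in measurable X]setTI; apply: measurable_tnth.
by rewrite -[X in measurable X]setTI; apply: measurable_behead.
Qed.

Let power_measure_cyl k (D : set (T * T)) (E : set (k.-tuple (T * T))) :
  measurable D -> measurable E ->
  power_measure mu2 k.+1 (cyl D E) = (mu2 D * power_measure mu2 k E)%E.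
Proof.
move=> mD mE; transitivity ((mu2 \x power_measure mu2 k)%E (D `*` E)); last first.
  exact: product_measure1E.
congr ((mu2 \x power_measure mu2 k)%E _); apply/funext => -[a t].
rewrite /cyl /preimage /mkset /=; congr (_ /\ E _); exact: val_inj.
Qed.

Let power_measure_cyl2 D1 D2 D3 :
  measurable D1 -> measurable D2 -> measurable D3 ->
  (mu2 D1 * (mu2 D2 * power_measure mu2 n D3))%E =
  power_measure mu2 n.+2 (cyl D1 (cyl D2 D3)).
Proof.
move=> m1 m2 m3; apply/esym.
exact: etrans (power_measure_cyl m1 (measurable_cyl m2 m3))
  (congr1 (fun x => mu2 D1 * x)%E (power_measure_cyl m2 m3)).
Qed.

Let cylP D1 D2 D3 (u : n.+2.-tuple (T * T)) :
  exists a b t, complex_of_tuple u = vec3 a b t /\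
    (cyl D1 (cyl D2 D3) u <-> [/\ D1 a, D2 b & D3 t]).
Proof.
exists (thead u), (thead [tuple of behead u]), [tuple of behead [tuple of behead u]]; split.
  congr complex_of_tuple; rewrite [LHS]tuple_eta; apply/val_inj => /=.
  by congr (_ :: _); exact: (congr1 val (tuple_eta [tuple of behead u])).
by split=> [[? [? ?]]|[? ? ?]].
Qed.

Lemma lebesgue_measureC_le (A : set (borelC R n.+2)) D1 D2 D3 :
  measurable A -> measurable D1 -> measurable D2 -> measurable D3 ->
  (forall a b t, A (vec3 a b t) -> [/\ D1 a, D2 b & D3 t]) ->
  (V A <= mu2 D1 * (mu2 D2 * power_measure mu2 n D3))%E.
Proof.
move=> mA m1 m2 m3 AD; have mC := measurable_cyl m1 (measurable_cyl m2 m3).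
rewrite (power_measure_cyl2 m1 m2 m3).
rewrite /lebesgue_measureC /image_measure /pushforward.
apply: le_measure; rewrite ?inE//.
  rewrite -[X in measurable X]setTI; exact: measurable_complex_of_tuple.
move=> u /= Au; have [a [b [t [ut h]]]] := cylP D1 D2 D3 u.
by apply/h/AD; rewrite -ut.
Qed.

Lemma lebesgue_measureC_ge (A : set (borelC R n.+2)) D1 D2 D3 :
  measurable A -> measurable D1 -> measurable D2 -> measurable D3 ->
  (forall a b t, D1 a -> D2 b -> D3 t -> A (vec3 a b t)) ->
  (mu2 D1 * (mu2 D2 * power_measure mu2 n D3) <= V A)%E.
Proof.
move=> mA m1 m2 m3 AD; have mC := measurable_cyl m1 (measurable_cyl m2 m3).
rewrite (power_measure_cyl2 m1 m2 m3).
rewrite /lebesgue_measureC /image_measure /pushforward.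
apply: le_measure; rewrite ?inE//.
  rewrite -[X in measurable X]setTI; exact: measurable_complex_of_tuple.
move=> u /= Cu; have [a [b [t [ut h]]]] := cylP D1 D2 D3 u.
by rewrite ut; have [h1 h2 h3] := h.1 Cu; exact: AD.
Qed.

(** Sections of a null set are null for almost all values of the first and of the
    remaining coordinates; in the plane of the second one the statement becomes
    that of [ae_rot_null]. *)
Lemma exists_good_circle (A : set (borelC R n.+2)) (phi : R -> R * R) c1 c2 c3 (r : R) :
  measurable A -> V A = 0%E -> measurable_fun [set: T] (phi : T -> T * T) ->
  (forall y, (phi y).1 ^+ 2 + (phi y).2 ^+ 2 = 1) -> 0 < r ->
  exists a b t, [/\ square c1 r a, square c2 r b, tbox c3 r t &
    {ae mu, forall y, ~ A (vec3 a (rot (phi y) b) t)}].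
Proof.
move=> mA A0 mphi phi1 r0.
have sq0 c : (0 < mu2 (square c r))%E.
  by rewrite lebesgue_measure2_square// lte_fin exprn_gt0// mulr_gt0.
have tb0 : (0 < power_measure mu2 n (tbox c3 r))%E.
  by rewrite power_measure_tbox// lte_fin !exprn_gt0// mulr_gt0.
pose B : set ((T * T) * n.+1.-tuple (T * T)) :=
  (@tcons _ _ n.+1) @^-1` (@complex_of_tuple R n.+2 @^-1` A).
have mB : measurable B.
  rewrite -[X in measurable X]setTI; apply: measurable_tcons => //.
  rewrite -[X in measurable X]setTI; exact: measurable_complex_of_tuple.
have := null_xsection (m1 := mu2) (m2 := power_measure mu2 n.+1) mB A0.
move=> /ae_exists/(_ (measurable_square c1 r) (sq0 c1))[a ca a0].
pose B' : set ((T * T) * n.-tuple (T * T)) := (@tcons _ _ n) @^-1` xsection B a.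
have mB' : measurable B'.
  rewrite -[X in measurable X]setTI; apply: measurable_tcons => //.
  exact: measurable_xsection.
have := null_ysection (m1 := mu2) (m2 := power_measure mu2 n) mB' a0.
move=> /ae_exists/(_ (measurable_tbox c3 r) tb0)[t ct t0].
have := ae_rot_null mphi phi1 (measurable_ysection t mB') t0.
move=> /ae_exists/(_ (measurable_square c2 r) (sq0 c2))[b cb bP].
exists a, b, t; split => //; apply: ae_mono bP => y; apply: contra_not => h.
by rewrite /ysection /= inE /B' /= /xsection /= inE.
Qed.

End coordinates.

(** * Euclidean norm and surface measure *)

Section euclidean_norm.
Context {R : realType} {d : nat}.
Implicit Types (z w : 'rV[R[i]]_d).

Lemma enorm_ge0 z : 0 <= enorm z.
Proof. exact: sqrtr_ge0. Qed.

Lemma enorm_sqr z : enorm z ^+ 2 = \sum_j normc (z ord0 j) ^+ 2.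
Proof.
rewrite /enorm sqr_sqrtr; first by apply: eq_bigr => j _; rewrite normc_sqr.
by apply: sumr_ge0 => j _; rewrite addr_ge0// sqr_ge0.
Qed.

Lemma enormZ (c : R[i]) z : enorm (c *: z) = normc c * enorm z.
Proof.
apply/eqP; rewrite -(eqrXn2 (ltn0Sn 1)) ?mulr_ge0 ?enorm_ge0 ?normc_ge0//.
rewrite exprMn !enorm_sqr mulr_sumr; apply/eqP; apply: eq_bigr => j _.
by rewrite !mxE normcM exprMn.
Qed.

Lemma normc_le_enorm z j : normc (z ord0 j) <= enorm z.
Proof.
rewrite -(ler_pXn2r (ltn0Sn 1)) ?nnegrE ?enorm_ge0 ?normc_ge0//.
by rewrite enorm_sqr (bigD1 j)//= lerDl sumr_ge0// => k _; exact: sqr_ge0.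
Qed.

Lemma enorm_lt1 z : (enorm z < 1) = (enorm z ^+ 2 < 1).
Proof.
by rewrite -[1 in RHS](expr1n _ 2) ltr_pXn2r// ?nnegrE ?enorm_ge0.
Qed.

Lemma enorm_gt0 z j : z ord0 j != 0 -> 0 < enorm z.
Proof. by move=> zj; apply: lt_le_trans (normc_le_enorm z j); rewrite normc_gt0. Qed.

End euclidean_norm.

Section surface.
Context {R : realType} {n : nat}.
Notation V := (@lebesgue_measureC R n.+2).
Notation sigma := (@surface_measure R n.+2).

Lemma enorm_vec3 (a b : R * R) (t : n.-tuple (R * R)) :
  enorm (vec3 a b t) ^+ 2 = (a.1 ^+ 2 + a.2 ^+ 2) + ((b.1 ^+ 2 + b.2 ^+ 2) +
    \sum_j ((tnth t j).1 ^+ 2 + (tnth t j).2 ^+ 2)).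
Proof.
rewrite enorm_sqr big_ord_recl vec3_0 normc_sqr; congr (_ + _).
rewrite big_ord_recl vec3_1 normc_sqr; congr (_ + _).
by apply: eq_bigr => j _; rewrite vec3_S normc_sqr.
Qed.

Lemma cball_unit_box (a b : R * R) (t : n.-tuple (R * R)) : cball (vec3 a b t) ->
  [/\ square (0, 0) 1 a, square (0, 0) 1 b & tbox [tuple (0, 0) | _ < n] 1 t].
Proof.
rewrite /cball /= => h.
have e j : normc (vec3 a b t ord0 j) < 1 by exact: le_lt_trans (normc_le_enorm _ _) h.
have sq (p : R * R) : normc (p.1 +i* p.2) < 1 -> square (0, 0) 1 p.
  move=> hp; apply/squareP; rewrite !subr0; split; apply: le_lt_trans hp.
    exact: Re_le_normc (p.1 +i* p.2).
  exact: Im_le_normc (p.1 +i* p.2).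
split; first by apply: sq; rewrite -(vec3_0 a b t).
  by apply: sq; rewrite -(vec3_1 a b t).
by move=> j; rewrite tnth_mktuple; apply: sq; rewrite -(vec3_S a b).
Qed.

(** The normalization of [surface_measure] divides by the real number
    [cball_volume], which would also be [0] if the volume were infinite. *)
Lemma cball_volume_gt0 : 0 < cball_volume R n.+2.
Proof.
have mB := @measurable_cball R n.+2.
have Vlt : (V (@cball R n.+2) < +oo)%E.
  apply: le_lt_trans (lebesgue_measureC_le mB (measurable_square (0, 0) 1)
    (measurable_square (0, 0) 1) (measurable_tbox [tuple (0, 0) | _ < n] 1) _) _.
    exact: cball_unit_box.
  by rewrite !lebesgue_measure2_square// power_measure_tbox// -!EFinM ltry.
have Vgt : (0 < V (@cball R n.+2))%E.
  have [r r0 rn] : exists2 r : R, 0 < r & r * (2 * (n%:R + 2)) = 1.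
    have n2 : 0 < 2 * (n%:R + 2) :> R by rewrite mulr_gt0// ltr_wpDl.
    by exists (2 * (n%:R + 2))^-1; rewrite ?invr_gt0// mulVf// gt_eqF.
  apply: lt_le_trans (lebesgue_measureC_ge mB (measurable_square (0, 0) r)
    (measurable_square (0, 0) r) (measurable_tbox [tuple (0, 0) | _ < n] r) _).
    rewrite !lebesgue_measure2_square// power_measure_tbox// -!EFinM lte_fin.
    by rewrite !mulr_gt0// !exprn_gt0// mulr_gt0.
  move=> a b t ha hb ht.
  have sq (p : R * R) : square (0, 0) r p -> p.1 ^+ 2 + p.2 ^+ 2 <= r ^+ 2 + r ^+ 2.
    move=> /squareP[]; rewrite /= !subr0 => h1 h2.
    have sqle (x : R) : `|x| < r -> x ^+ 2 <= r ^+ 2.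
      move=> xr; rewrite -(real_normK (num_real x)).
      by apply: lerXn2r; [rewrite nnegrE|rewrite nnegrE ltW|exact: ltW].
    by apply: lerD; exact: sqle.
  rewrite /cball /= enorm_lt1 enorm_vec3.
  apply: (@le_lt_trans _ _ ((r ^+ 2 + r ^+ 2) + ((r ^+ 2 + r ^+ 2) +
      \sum_(j < n) (r ^+ 2 + r ^+ 2)))).
    apply: lerD; first exact: sq. apply: lerD; first exact: sq.
    by apply: ler_sum => j _; apply: sq; have := ht j; rewrite tnth_mktuple.
  rewrite sumr_const card_ord -mulr_natl.
  rewrite (_ : _ + _ = r * (r * (2 * (n%:R + 2)))); last by ring.
  rewrite rn mulr1 -rn ltr_pMr//.
  by have := ler0n R n; lra.
by rewrite /cball_volume fine_gt0// Vgt Vlt.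
Qed.

(** The cone over a [surface_measure]-null set is Lebesgue null, because the
    normalizing constant is not [0]. *)
Lemma ae_surface_cone (P : 'rV[R[i]]_n.+2 -> Prop) :
  {ae sigma, forall z, P z} ->
  exists A : set (borelC R n.+2), [/\ measurable A, V A = 0%E &
    forall z : borelC R n.+2, cball z -> ~ A z -> P (radial_proj z)].
Proof.
move=> [N [mN N0 PN]].
exists (@radial_proj R n.+2 @^-1` N `&` @cball R n.+2); split.
- apply: measurableI; last exact: measurable_cball.
  rewrite -[X in measurable X]setTI; exact: measurable_radial_proj.
- move: N0; rewrite surface_measureE => /eqP; rewrite mule_eq0 => /orP[|/eqP//].
  by rewrite eqe invr_eq0 gt_eqF// cball_volume_gt0.
- move=> z zB nA; apply: contrapT => nP; apply: nA; split => //.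
  exact: PN.
Qed.

End surface.

(** * Discs in the direction of the second coordinate *)

Section slice_bound.
Context {R : realType}.

Lemma nbhs_rowP d (z : 'rV[R[i]]_d) (U : set 'rV[R[i]]_d) : nbhs z U <->
  exists2 r : R, 0 < r & forall w : 'rV[R[i]]_d, (forall j, normc (w ord0 j - z ord0 j) < r) -> U w.
Proof.
split=> [/nbhs_ballP[e /= /complex_gt0[e0 ->] eU]|[r r0 rU]].
  exists (complex.Re e) => // w wz; apply: eU; split; first by rewrite ltcR.
  by move=> i j; rewrite ord1 /ball/= distrC ltcR.
apply/nbhs_ballP; exists r%:C; first by rewrite /= ltcR.
by move=> w [_ wz]; apply: rU => j; have := wz ord0 j; rewrite /ball/= distrC ltcR.
Qed.

(** The automorphism of the disc taking [0] to [s]. *)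
Definition moebius (s : R) (l : R[i]) : R[i] := (l + s%:C) / (1 + s%:C * l).

Section moebius.
Variables (s : R) (s0 : 0 <= s) (s1 : s < 1).

Lemma moebius_den l : normc l <= 1 -> 1 + s%:C * l != 0.
Proof.
move=> l1; rewrite -normc_gt0.
have h : normc (s%:C * l) <= s by rewrite normcM normcR ger0_norm// ler_piMr.
have := normc_lerB 1 (- (s%:C * l)); rewrite opprK normc1 normcNE.
by apply: lt_le_trans; rewrite subr_gt0 (le_lt_trans h).
Qed.

Lemma moebius_norm l : normc l <= 1 ->
  normc (moebius s l) ^+ 2 = 1 - (1 - s ^+ 2) * (1 - normc l ^+ 2) / normc (1 + s%:C * l) ^+ 2.
Proof.
move=> l1; have d0 := moebius_den l1.
have n0 : normc (1 + s%:C * l) ^+ 2 != 0 by rewrite sqrf_eq0 normc_eq0.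
rewrite /moebius normcM normcV exprMn exprVn.
apply: (mulIf n0); rewrite mulrBl !divfK//.
by rewrite !normc_sqr; case: l l1 d0 n0 => x y _ _ _ /=; ring.
Qed.

Lemma moebius_le1 l : normc l <= 1 -> normc (moebius s l) <= 1.
Proof.
move=> l1; rewrite -[leRHS](expr1n _ 1) -(ler_pXn2r (ltn0Sn 1)) ?nnegrE ?normc_ge0//.
rewrite moebius_norm// !expr1n lerBlDr lerDl divr_ge0 ?sqr_ge0// mulr_ge0//.
  by rewrite subr_ge0 expr_le1// ltW.
by rewrite subr_ge0 expr_le1// normc_ge0.
Qed.

Lemma moebius_circle l : normc l = 1 -> normc (moebius s l) ^+ 2 = 1.
Proof.
by move=> l1; rewrite moebius_norm ?l1// expr1n subrr mulr0 mul0r subr0.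
Qed.

Lemma moebius0 : moebius s 0 = s%:C.
Proof. by rewrite /moebius mulr0 addr0 divr1 add0r. Qed.

Lemma differentiable_moebius l : normc l <= 1 -> differentiable (moebius s) l.
Proof.
move=> l1; have did : differentiable (@id R[i]) l.
  by apply/derivable1_diffP; exact: derivable_id.
apply: differentiableM.
  by apply: differentiableD; [exact: did|exact: differentiable_cst].
apply: differentiableV; last exact: moebius_den.
apply: differentiableD; first exact: differentiable_cst.
by apply: differentiableM; [exact: differentiable_cst|exact: did].
Qed.

End moebius.

Section scale.
Context {d : nat}.
Implicit Types (z : 'rV[R[i]]_d) (j k : 'I_d) (c : R[i]).

(** Multiplication of the coordinate [j] by [c], written so as to be visibly
    affine, hence differentiable, in [c]. *)
Definition scale j c z : 'rV[R[i]]_d := z + (c - 1) *: (z ord0 j *: delta_mx ord0 j).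

Lemma scaleE j c z k :
  scale j c z ord0 k = if k == j then c * z ord0 j else z ord0 k.
Proof.
rewrite !mxE eqxx /=; case: eqP => [->|_]; last by rewrite !mulr0 addr0.
by rewrite mulr1 mulrBl mul1r addrC subrK.
Qed.

Lemma enorm_scale j c z :
  enorm (scale j c z) ^+ 2 = enorm z ^+ 2 - (1 - normc c ^+ 2) * normc (z ord0 j) ^+ 2.
Proof.
rewrite !enorm_sqr (bigD1 j)//= [in RHS](bigD1 j)//= scaleE eqxx normcM exprMn.
under eq_bigr => k /negbTE kj do rewrite scaleE kj.
by ring.
Qed.

Lemma enorm_scale_le j c z : normc c <= 1 -> enorm (scale j c z) <= enorm z.
Proof.
move=> c1; rewrite -(ler_pXn2r (ltn0Sn 1)) ?nnegrE ?enorm_ge0// enorm_scale.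
by rewrite lerBlDr lerDl mulr_ge0 ?sqr_ge0// subr_ge0 expr_le1// normc_ge0.
Qed.

Lemma enorm_scale_lt j c z : normc c < 1 -> z ord0 j != 0 ->
  enorm (scale j c z) < enorm z.
Proof.
move=> c1 zj; rewrite -(ltr_pXn2r (ltn0Sn 1)) ?nnegrE ?enorm_ge0// enorm_scale.
rewrite ltrBlDr ltrDl mulr_gt0//; last by rewrite exprn_gt0// normc_gt0.
by rewrite subr_gt0 expr_lt1// normc_ge0.
Qed.

End scale.
End slice_bound.

(** * From a bound on the sphere to a bound in the ball *)

Section radii.
Context {R : realType}.

Definition radius (k : nat) : R := 1 - (k.+2%:R)^-1.

Lemma radius_ge0 k : 0 <= radius k.
Proof. by rewrite subr_ge0 invf_le1// ler1n. Qed.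

Lemma radius_lt1 k : radius k < 1.
Proof. by rewrite ltrBlDr ltrDl invr_gt0. Qed.

Lemma radius_cvg : radius @ \oo --> (1 : R).
Proof.
rewrite -[X in _ --> X]subr0; apply: cvgB; first exact: cvg_cst.
apply/cvgrPdist_lt => e e0.
have [N _ NP] := near_infty_natSinv_lt (PosNum e0).
exists N => // k Nk /=; rewrite sub0r normrN ger0_norm ?invr_ge0//.
by apply: (NP k.+1); exact: leqW.
Qed.

Lemma radius_cvg_left : radius @ \oo --> (1 : R)^'-.
Proof.
move=> P hP.
have : \forall k \near \oo, radius k < 1 -> P (radius k) := radius_cvg hP.
by apply: filterS => k; apply; exact: radius_lt1.
Qed.

End radii.

Section boundary_to_ball.
Context {R : realType} {n : nat}.
Notation mu := (@lebesgue_measure R).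
Notation T := (measurableTypeR R).
Notation sigma := (@surface_measure R n.+2).
Notation i1 := (lift ord0 ord0 : 'I_n.+2).
Implicit Types (m mstar : 'rV[R[i]]_n.+2 -> R[i]) (z : 'rV[R[i]]_n.+2).

(** The points [rho *: scale i1 l z], [normc l <= 1], form the disc where only the
    second coordinate varies.  The Moebius map puts the point [s] of the disc at
    its centre, and the dilations by [radius k] make the functions analytic up to
    the boundary, their boundary values converging to those of [m] along radii
    of the ball. *)
Lemma slice_estimate m mstar (h : R[i] -> R) (s M0 : R) (a b : R * R)
    (t : n.-tuple (R * R)) :
  0 <= s -> s < 1 ->
  (forall z, cball z -> differentiable m z) ->
  (forall z, cball z -> normc (m z) <= M0) ->
  vec3 a b t ord0 i1 != 0 ->
  let rho := (enorm (vec3 a b t))^-1 in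
  {ae mu, forall y : R,
     let w := rho%:C *: scale i1 (moebius s (cis y)) (vec3 a b t) in
     m (r%:C *: w) @[r --> (1 : R)^'-] --> mstar w /\
     normc (mstar w) <= h (w ord0 ord0)} ->
  normc (m (rho%:C *: scale i1 s%:C (vec3 a b t))) <= h (rho%:C * (vec3 a b t) ord0 ord0).
Proof.
move=> s0 s1 dm bm; move: (vec3 a b t) => z z1 rho aeP.
have z0 := enorm_gt0 z1.
have rho0 : 0 < rho by rewrite invr_gt0.
pose f k (l : R[i]) := m ((radius k)%:C *: (rho%:C *: scale i1 (moebius s l) z)).
have inB k l : normc l <= 1 ->
    cball ((radius k)%:C *: (rho%:C *: scale i1 (moebius s l) z)).
  move=> l1; rewrite /cball /= enormZ normcR ger0_norm ?radius_ge0//.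
  apply: le_lt_trans (radius_lt1 k); rewrite ler_piMr ?radius_ge0//.
  rewrite enormZ normcR gtr0_norm// mulrC ler_pdivrMr// mul1r.
  exact/enorm_scale_le/moebius_le1.
have df k l : normc l <= 1 -> differentiable (f k) l.
  move=> l1; apply: (@differentiable_comp _ _ _ _
    (fun l => (radius k)%:C *: (rho%:C *: scale i1 (moebius s l) z)) m); last exact/dm/inB.
  apply: differentiableZ; apply: differentiableZ.
  apply: differentiableD; first exact: differentiable_cst.
  apply: differentiableZl; apply: differentiableD; last exact: differentiable_cst.
  exact: differentiable_moebius.
apply: (@circle_limit_le R f M0 _ _ df).
- by move=> k l l1; exact/bm/inB.
- apply: ae_mono aeP => y [ml hw] _ e e0.
  have zE : (rho%:C *: scale i1 (moebius s (cis y)) z) ord0 ord0 = rho%:C * z ord0 ord0.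
    by rewrite mxE scaleE.
  rewrite zE in hw.
  have fl : (fun k => normc (f k (cis y))) @ \oo -->
      normc (mstar (rho%:C *: scale i1 (moebius s (cis y)) z)).
    apply: (cvg_comp (fun k => f k (cis y)) (@normc R)); last exact: normc_continuous.
    exact: (cvg_comp radius _ radius_cvg_left ml).
  move/cvgrPdist_lt : fl => /(_ e e0); apply: filterS => k; rewrite ltr_distlC => /andP[_ fk].
  by apply: ltW; apply: lt_le_trans fk _; rewrite lerD2r.
- rewrite /f moebius0; apply: (cvg_comp _ (@normc R)); last exact: normc_continuous.
  have wB : cball (rho%:C *: scale i1 s%:C z).
    rewrite /cball /= enormZ normcR gtr0_norm// mulrC ltr_pdivrMr// mul1r.
    by apply: enorm_scale_lt => //; rewrite normcR ger0_norm.
  have mc : {for rho%:C *: scale i1 s%:C z, continuous m}.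
    exact/differentiable_continuous/dm.
  have cw : (fun k => (radius k)%:C *: (rho%:C *: scale i1 s%:C z)) @ \oo -->
      rho%:C *: scale i1 s%:C z.
    rewrite -[X in _ --> X]scale1r; apply: cvgZ; last exact: cvg_cst.
    by apply: (cvg_comp radius (fun x : R => x%:C) radius_cvg); exact: realC_continuous.
  exact: (cvg_comp _ m cw mc).
Qed.

Lemma hinfty_normc m : Hinfty m -> (forall z, cball z -> differentiable m z) /\
  exists M0, forall z, cball z -> normc (m z) <= M0.
Proof. by move=> [dm [M hM]]; split => //; exists M => z /hM; rewrite lecR. Qed.

Lemma scaleZ (c l : R[i]) z : scale i1 c (l *: z) = l *: scale i1 c z.
Proof.
have lE (w : 'rV[R[i]]_n.+2) k : (l *: w) ord0 k = l * w ord0 k by rewrite mxE.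
by apply/rowP => k; rewrite lE !scaleE !lE; case: eqP => // _; rewrite mulrCA.
Qed.

Lemma scale_vec3 (c : R[i]) (a b : R * R) (t : n.-tuple (R * R)) :
  scale i1 c (vec3 a b t) = vec3 a (rot (complex.Re c, complex.Im c) b) t.
Proof.
apply/rowP => k; rewrite scaleE.
case: (unliftP ord0 k) => [k' ->|->]; last by rewrite !vec3_0.
case: (unliftP ord0 k') => [k'' ->|->]; first by rewrite !vec3_S.
by rewrite eqxx !vec3_1; case: c => x y; rewrite /rot /= (addrC (y * _)).
Qed.

Lemma vec3_close z (r : R) (a b : R * R) (t : n.-tuple (R * R)) :
  let ri (w : R[i]) := (complex.Re w, complex.Im w) in
  square (ri (z ord0 ord0)) (r / 2) a -> square (ri (z ord0 i1)) (r / 2) b ->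
  tbox [tuple ri (z ord0 (lift ord0 (lift ord0 k))) | k < n] (r / 2) t ->
  forall j, normc (vec3 a b t ord0 j - z ord0 j) < r.
Proof.
move=> ri ha hb ht.
have sq (w : R[i]) (c : R * R) : square (ri w) (r / 2) c -> normc (c.1 +i* c.2 - w) < r.
  move=> /squareP[]; case: w => x y h1 h2.
  apply: le_lt_trans (normc_le_ReIm _) _ => /=.
  by rewrite [ltRHS]splitr; apply: ltrD; [exact: h1|exact: h2].
move=> j; case: (unliftP ord0 j) => [j' ->|->]; last by rewrite vec3_0; exact: sq.
case: (unliftP ord0 j') => [k ->|->]; last by rewrite vec3_1; exact: sq.
by rewrite vec3_S; apply: sq; have := ht k; rewrite tnth_mktuple.
Qed.

(** The point [z] is where the ray in the second coordinate, from the centre of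
    the disc through [p], leaves the ball. *)
Lemma ball_slice p : cball p -> exists s z, [/\ 0 <= s, s < 1, enorm z = 1,
  z ord0 i1 != 0 & scale i1 s%:C z = p].
Proof.
move=> pB; set p1 := p ord0 i1; pose x := normc p1.
have x0 : 0 <= x by exact: normc_ge0.
have E1 : enorm p ^+ 2 < 1 by rewrite -enorm_lt1.
have xE : x ^+ 2 <= enorm p ^+ 2 by rewrite lerXn2r ?nnegrE ?enorm_ge0//; exact: normc_le_enorm.
pose Q2 := 1 - enorm p ^+ 2 + x ^+ 2; pose Q := Num.sqrt Q2.
have xQ2 : x ^+ 2 < Q2 by rewrite /Q2 ltrDr subr_gt0.
have Q20 : 0 < Q2 by exact: le_lt_trans (sqr_ge0 x) xQ2.
have Q0 : 0 < Q by rewrite sqrtr_gt0.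
have QE : Q ^+ 2 = Q2 by rewrite sqr_sqrtr// ltW.
have xQ : x < Q by rewrite -(ltr_pXn2r (ltn0Sn 1)) ?nnegrE ?(ltW Q0)// QE.
have [u u1 pu] : exists2 u : R[i], normc u = 1 & p1 = x%:C * u.
  have [p10|p10] := eqVneq p1 0.
    by exists 1; [exact: normc1|rewrite /x p10 normc0 mul0r].
  have nx : normc p1 != 0 by rewrite normc_eq0.
  exists ((x^-1)%:C * p1); first by rewrite normcM normcR ger0_norm ?invr_ge0// mulVf.
  by rewrite mulrA -rmorphM/= divff// mul1r.
pose z : 'rV[R[i]]_n.+2 := p + (Q%:C * u - p1) *: delta_mx ord0 i1.
have zE k : z ord0 k = if k == i1 then Q%:C * u else p ord0 k.
  rewrite !mxE eqxx /=; case: eqP => [->|_]; last by rewrite mulr0 addr0.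
  by rewrite mulr1 addrC subrK.
have sz : scale i1 (x / Q)%:C z = p.
  apply/rowP => k; rewrite scaleE !zE eqxx; case: eqP => // ->.
  by rewrite mulrA -rmorphM/= divfK ?gt_eqF// -pu.
exists (x / Q), z; split=> //.
- by rewrite divr_ge0// ltW.
- by rewrite ltr_pdivrMr// mul1r.
- apply/eqP; rewrite -(eqrXn2 (ltn0Sn 1)) ?enorm_ge0// expr1n.
  have := enorm_scale i1 (x / Q)%:C z; rewrite sz => /eqP.
  rewrite -subr_eq opprK => /eqP <-.
  rewrite zE eqxx normcM u1 mulr1 !normcR (gtr0_norm Q0) real_normK ?num_real//.
  have -> : (1 - (x / Q) ^+ 2) * Q ^+ 2 = Q ^+ 2 - x ^+ 2 by field; rewrite gt_eqF.
  by rewrite QE /Q2; apply/eqP; ring.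
- by rewrite zE eqxx -normc_eq0 normcM u1 mulr1 normcR gtr0_norm// gt_eqF.
Qed.

(** The maximum principle on the discs where only the second coordinate varies
    transports a bound depending on the first coordinate from the sphere to the
    ball.  Almost every such disc has almost all its boundary in the good set;
    the remaining points of the ball are reached by continuity. *)
Theorem boundary_bound_in_ball m mstar (h : R[i] -> R) :
  continuous h -> Hinfty m -> boundary_function m mstar ->
  {ae sigma, forall z, csphere z -> normc (mstar z) <= h (z ord0 ord0)} ->
  forall p, cball p -> normc (m p) <= h (p ord0 ord0).
Proof.
move=> ch /hinfty_normc[dm [M0 bm]] bmm bh p pB.
have [A [mA A0 AP]] := ae_surface_cone (ae_conj bmm bh).
have [s [z0 [s0 s1 z01 z0i zp]]] := ball_slice pB.
(* surface_measure is defined by cones, so the good circles are looked for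
   inside the ball, around a multiple of the point of the sphere *)
pose c := (2^-1 : R)%:C *: z0.
have hc : enorm c = 2^-1 by rewrite enormZ z01 mulr1 normcR ger0_norm.
have ci : c ord0 i1 != 0.
  by rewrite mxE mulf_neq0// -normc_eq0 normcR normr_eq0 invr_eq0 pnatr_eq0.
pose F z : 'rV[R[i]]_n.+2 := ((enorm z)^-1)%:C *: scale i1 s%:C z.
have Fc : F c = p.
  by rewrite /F hc /c scaleZ scalerA -rmorphM/= mulVf ?scale1r// invr_eq0 pnatr_eq0.
have cF : {for c, continuous F}.
  have cc k : {for c, continuous (fun z : 'rV[R[i]]_n.+2 => z ord0 k)}.
    exact: coord_continuous.
  apply: (@cvgZ _ _ _ (nbhs c)).
    apply: (@continuous_comp _ _ _ (fun z : 'rV[R[i]]_n.+2 => (enorm z)^-1) (fun a => a%:C));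
      last exact: realC_continuous.
    apply: (@cvgV _ _ (nbhs c)); last exact: enorm_continuous.
    by rewrite hc invr_eq0 pnatr_eq0.
  apply: (@cvgD _ _ _ (nbhs c)); first exact: cvg_id.
  apply: (@cvgZ _ _ _ (nbhs c)); first exact: cvg_cst.
  by apply: (@cvgZ _ _ _ (nbhs c)); [exact: cc|exact: cvg_cst].
rewrite leNgt; apply/negP => hp.
have U : \forall z \near c, h (F z ord0 ord0) < normc (m (F z)).
  have c1 : {for c, continuous (fun z => h (F z ord0 ord0))}.
    apply: (continuous_comp (f := fun z => F z ord0 ord0)); last exact: ch.
    apply: (continuous_comp (f := F) (g := fun w : 'rV[R[i]]_n.+2 => w ord0 ord0)) => //.
    exact: coord_continuous.
  have c2 : {for c, continuous (fun z => normc (m (F z)))}.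
    apply: (continuous_comp (f := fun z => m (F z))); last exact: normc_continuous.
    apply: (continuous_comp (f := F)); [exact: cF|rewrite Fc].
    exact/differentiable_continuous/dm.
  have : 0 < normc (m (F c)) - h (F c ord0 ord0) by rewrite subr_gt0 Fc.
  have c3 : {for c, continuous (fun z => normc (m (F z)) - h (F z ord0 ord0))}.
    exact: (@cvgB _ _ _ (nbhs c) _ _ _ _ _ c2 c1).
  move=> /(cvgr_gt _ c3); apply: filterS => z; by rewrite subr_gt0.
have UB : \forall z \near c, cball z.
  apply: open_nbhs_nbhs; split; first exact: open_cball.
  by rewrite /cball /= hc invf_lt1// ltr1n.
have Ui : \forall z \near c, (z : 'rV[R[i]]_n.+2) ord0 i1 != 0.
  have cc : {for c, continuous (fun z : 'rV[R[i]]_n.+2 => normc (z ord0 i1))}.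
    apply: (continuous_comp (f := fun w : 'rV[R[i]]_n.+2 => w ord0 i1));
      [exact: coord_continuous|exact: normc_continuous].
  have : 0 < normc (c ord0 i1) by rewrite normc_gt0.
  by move=> /(cvgr_gt _ cc); apply: filterS => z; rewrite normc_gt0.
have [r r0 rP] := (nbhs_rowP _ _).1 (filterI U (filterI UB Ui)).
pose mb y := moebius s (cis y).
pose phi (y : R) := (complex.Re (mb y), complex.Im (mb y)).
have mphi : measurable_fun [set: T] (phi : T -> T * T).
  have cmb : continuous mb.
    move=> y; apply: (continuous_comp (f := cis)); first exact: continuous_cis.
    by apply/differentiable_continuous/differentiable_moebius; rewrite ?normc_cis.
  apply/measurable_fun_pairP; split; apply: continuous_measurable_fun => y.
    by apply: (continuous_comp (f := mb)); [exact: cmb|exact: Re_continuous].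
  by apply: (continuous_comp (f := mb)); [exact: cmb|exact: Im_continuous].
have nmb y : normc (mb y) ^+ 2 = 1 by rewrite moebius_circle// normc_cis.
have phi1 y : (phi y).1 ^+ 2 + (phi y).2 ^+ 2 = 1 by rewrite -normc_sqr.
have r20 : 0 < r / 2 by rewrite divr_gt0.
have [a [b [t [ha hb ht gy]]]] := exists_good_circle
  (complex.Re (c ord0 ord0), complex.Im (c ord0 ord0))
  (complex.Re (c ord0 i1), complex.Im (c ord0 i1))
  [tuple (complex.Re (c ord0 (lift ord0 (lift ord0 k))),
          complex.Im (c ord0 (lift ord0 (lift ord0 k)))) | k < n]
  mA A0 mphi phi1 r20.
have [hF [zB zi]] := rP _ (vec3_close ha hb ht).
suff est : normc (m (F (vec3 a b t))) <= h (F (vec3 a b t) ord0 ord0).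
  by move: hF; rewrite ltNge est.
have -> : F (vec3 a b t) ord0 ord0 = ((enorm (vec3 a b t))^-1)%:C * vec3 a b t ord0 ord0.
  by rewrite /F mxE scaleE.
apply: (@slice_estimate m mstar h s M0 a b t s0 s1 dm bm zi).
apply: ae_mono gy => y nA.
have zyE : vec3 a (rot (phi y) b) t = scale i1 (mb y) (vec3 a b t).
  by rewrite scale_vec3.
rewrite zyE in nA.
have ezy : enorm (scale i1 (mb y) (vec3 a b t)) = enorm (vec3 a b t).
  by apply/eqP; rewrite -(eqrXn2 (ltn0Sn 1)) ?enorm_ge0// enorm_scale nmb subrr mul0r subr0.
have zyB : cball (scale i1 (mb y) (vec3 a b t)) by rewrite /cball /= ezy.
have := AP _ zyB nA; rewrite /radial_proj ezy; set w := _ *: scale _ _ _.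
have wS : csphere w.
  rewrite /csphere /= enormZ normcR ger0_norm ?invr_ge0 ?enorm_ge0// ezy mulVf//.
  by rewrite gt_eqF// (enorm_gt0 zi).
by move=> [/(_ wS) h1 /(_ wS) h2].
Qed.

End boundary_to_ball.

(** * Fast decay at a boundary point forces vanishing *)

Section decay.
Context {R : realType}.
Implicit Types x y : R.

(** Near [0] this decays faster than [expR (- c / x)] for every [c], as needed for
    vanishing, while its logarithm [- x ^ (-3/2)] blows up slowly enough to be
    integrable against a measure giving mass of order [e ^ 2] to [x <= e]. *)
Definition decay x : R := if x == 0 then 0 else expR (- (`|x| * Num.sqrt `|x|)^-1).

Lemma decay0 : decay 0 = 0.
Proof. by rewrite /decay eqxx. Qed.

Lemma decay_gt0 x : x != 0 -> 0 < decay x.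
Proof. by move=> /negbTE x0; rewrite /decay x0 expR_gt0. Qed.

Lemma decay_ge0 x : 0 <= decay x.
Proof. by rewrite /decay; case: ifP => // _; exact: expR_ge0. Qed.

Lemma decay_le1 x : decay x <= 1.
Proof.
rewrite /decay; case: ifP => _; first exact: ler01.
by rewrite -expR0 ler_expR oppr_le0 invr_ge0 mulr_ge0.
Qed.

Lemma decay_eq0 x : decay x = 0 -> x = 0.
Proof. by move=> dx; apply/eqP; apply: contraTT isT => /decay_gt0; rewrite dx ltxx. Qed.

Lemma decay_le x : `|x| <= 1 -> decay x <= `|x|.
Proof.
move=> x1; have [->|x0] := eqVneq x 0; first by rewrite decay0 normr0.
have nx : 0 < `|x| by rewrite normr_gt0.
have s0 : 0 < Num.sqrt `|x| by rewrite sqrtr_gt0.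
have s1 : Num.sqrt `|x| <= 1 by rewrite -sqrtr1 ler_wsqrtr.
have u0 : 0 < `|x| * Num.sqrt `|x| by rewrite mulr_gt0.
rewrite /decay (negbTE x0); apply: (@le_trans _ _ (`|x| * Num.sqrt `|x|)).
  rewrite expRN -[leRHS]invrK lef_pV2 ?posrE ?expR_gt0 ?invr_gt0//.
  by have := expR_ge1Dx ((`|x| * Num.sqrt `|x|)^-1); lra.
by rewrite ler_piMr.
Qed.

Lemma decay_continuous : continuous decay.
Proof.
move=> x; have [->|x0] := eqVneq x 0.
  apply/cvgrPdist_lt => e e0; rewrite decay0; near=> y.
  rewrite sub0r normrN ger0_norm ?decay_ge0//.
  apply: (@le_lt_trans _ _ `|y|).
    apply: decay_le; apply: ltW; near: y.
    have := @cvgr0_norm_lt _ _ _ (nbhs (0 : R)) _ id cvg_id 1 ltr01; exact.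
  near: y; have := @cvgr0_norm_lt _ _ _ (nbhs (0 : R)) _ id cvg_id e e0; exact.
have cE : {for x, continuous (fun y : R => expR (- (`|y| * Num.sqrt `|y|)^-1))}.
  apply: (continuous_comp (f := fun y : R => - (`|y| * Num.sqrt `|y|)^-1)); last exact: continuous_expR.
  apply: (@cvgN _ _ _ (nbhs x)); apply: (@cvgV _ _ (nbhs x)).
    by rewrite mulf_neq0 ?normr_eq0// gt_eqF// sqrtr_gt0 normr_gt0.
  apply: (@cvgM _ _ (nbhs x)); first exact: norm_continuous.
  apply: (continuous_comp (f := fun y : R => `|y|)); first exact: norm_continuous.
  exact: sqrt_continuous.
have xE : decay x = expR (- (`|x| * Num.sqrt `|x|)^-1) by rewrite /decay (negbTE x0).
rewrite /continuous_at xE; apply: cvg_trans cE; apply: near_eq_cvg.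
have U : nbhs x [set y : R | y != 0].
  by apply: open_nbhs_nbhs; split=> //; exact: open_neq.
near=> y; rewrite /decay ifF//; apply/negbTE; near: y; exact: U.
Unshelve. all: by end_near. Qed.

(** The exponent is [c y - y ^ (3/2)]: at most [0] for [y >= c ^ 2], and at most
    [c y <= c ^ 3] otherwise. *)
Lemma decay_expR_le (c y : R) : 0 <= c -> 0 < y -> decay y^-1 * expR (c * y) <= expR (c ^+ 3).
Proof.
move=> c0 y0; rewrite /decay invr_eq0 gt_eqF// -expRD ler_expR.
rewrite gtr0_norm ?invr_gt0// sqrtrV ?(ltW y0)// -invfM invrK.
have := sqrtr_ge0 y; have : Num.sqrt y ^+ 2 = y by rewrite sqr_sqrtr// ltW.
move: (Num.sqrt y) => q <- q0.
have [cq|qc] := leP c q.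
  apply: (@le_trans _ _ 0); last by rewrite exprn_ge0.
  rewrite addrC subr_le0 [leRHS]mulrC; apply: ler_wpM2r => //; exact: sqr_ge0.
apply: (@le_trans _ _ (c * q ^+ 2)).
  by rewrite gerDr oppr_le0 mulr_ge0// sqr_ge0.
rewrite (exprS c); apply: ler_wpM2l => //.
by apply: lerXn2r; rewrite ?nnegrE// (ltW qc).
Qed.

End decay.

Section vanishing.
Context {R : realType} {n : nat}.
Notation E1 := (@e1 R n.+2).
Implicit Types (m : 'rV[R[i]]_n.+2 -> R[i]) (z w : 'rV[R[i]]_n.+2).

Lemma enorm_e1D (c : R[i]) w : enorm (E1 + c *: w) ^+ 2 =
  1 + 2 * complex.Re (c * w ord0 ord0) + normc c ^+ 2 * enorm w ^+ 2.
Proof.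
rewrite !enorm_sqr big_ord_recl [in RHS]big_ord_recl.
have -> : \sum_(j < n.+1) normc ((E1 + c *: w) ord0 (lift ord0 j)) ^+ 2 =
    normc c ^+ 2 * \sum_(j < n.+1) normc (w ord0 (lift ord0 j)) ^+ 2.
  by rewrite mulr_sumr; apply: eq_bigr => j _; rewrite !mxE add0r normcM exprMn.
have -> : (E1 + c *: w) ord0 ord0 = 1 + c * w ord0 ord0 by rewrite !mxE.
have -> : normc (1 + c * w ord0 ord0) ^+ 2 =
    1 + 2 * complex.Re (c * w ord0 ord0) + normc c ^+ 2 * normc (w ord0 ord0) ^+ 2.
  rewrite -exprMn -normcM !normc_sqr; case: (c * _) => x y /=; ring.
by rewrite mulrDr addrA.
Qed.

(** On the complex line through [e1] and a point of the ball, [1 / (1 - z_1)]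
    maps the slice of the ball to a half plane [Re > A].  There [m] is bounded
    by [expR (- c |u| ^ (3/2))], so [m * expR (N u)] is bounded for every [N],
    with boundary values at most [expR (N A)].  By the maximum principle the
    same holds inside, where [N] may be arbitrarily large. *)
Theorem decay_vanishing m :
  (forall z, cball z -> differentiable m z) ->
  (forall z, cball z -> normc (m z) <= decay (normc (1 - z ord0 ord0))) ->
  forall p, cball p -> m p = 0.
Proof.
move=> dm bm p pB.
have [w pE] : exists w, p = E1 + 1 *: w.
  by exists (p - E1); rewrite scale1r addrC subrK.
pose W := normc (w ord0 ord0) ^+ 2.
pose A := enorm w ^+ 2; pose kap : R[i] := - 2%:C * (w ord0 ord0)^*%C.
pose b := complex.Re kap - A.
have kapRe : complex.Re kap = - (2 * complex.Re (w ord0 ord0)).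
  by rewrite /kap; case: (w _ _) => x y /=; ring.
have b0 : 0 < b.
  move: pB; rewrite /cball /= enorm_lt1 {1}pE enorm_e1D normc1 expr1n !mul1r -/A.
  by rewrite /b kapRe; lra.
have A0 : 0 <= A by rewrite sqr_ge0.
have W0 : 0 < W.
  rewrite exprn_gt0// normc_gt0; apply/eqP => w0.
  by move: b0; rewrite /b kapRe w0 /=; lra.
have kapw : kap * w ord0 ord0 = (- (2 * W))%:C.
  rewrite /W normc_sqr /kap; case: (w _ _) => x y /=.
  by apply/eqP; rewrite eq_complex /=; apply/andP; split; apply/eqP; ring.
have kapn : normc kap ^+ 2 = 4 * W.
  rewrite /W !normc_sqr /kap; case: (w _ _) => x y /=; ring.
(* the inverse of the map of the slice onto the half plane *)
pose Q (u : R[i]) := E1 + (kap / u) *: w.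
have QB u : A < complex.Re u -> cball (Q u).
  move=> Au; have u0 : 0 < normc u ^+ 2.
    rewrite normc_sqr ltr_pwDl ?sqr_ge0// exprn_gt0//; exact: le_lt_trans Au.
  rewrite /cball /= enorm_lt1 enorm_e1D -/A mulrAC kapw normcM normcV exprMn exprVn kapn.
  have -> : complex.Re ((- (2 * W))%:C / u) = - (2 * W) * complex.Re u / normc u ^+ 2.
    rewrite normc_sqr; case: (u) => x y /=; ring.
  rewrite -[X in _ < X]addr0 -addrA ltrD2l.
  rewrite (_ : _ + _ = - (4 * W * (complex.Re u - A) / normc u ^+ 2)); last by ring.
  rewrite oppr_lt0; apply: divr_gt0 => //; apply: mulr_gt0; last by rewrite subr_gt0.
  exact: mulr_gt0.
have Qdecay u : u != 0 -> normc (1 - Q u ord0 ord0) = (normc u / (2 * W))^-1.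
  move=> u0; have -> : Q u ord0 ord0 = 1 + kap / u * w ord0 ord0 by rewrite !mxE.
  rewrite opprD addrA subrr sub0r mulrAC kapw normcNE normcM normcR normcV.
  have -> : `|- (2 * W)| = 2 * W by rewrite normrN gtr0_norm// mulr_gt0.
  by rewrite invf_div.
(* from the unit disc to the half plane, taking 0 to the parameter kap of p *)
pose M (u : R[i]) := (A +i* complex.Im kap) + b%:C * ((1 + u) / (1 - u)).
have MRe u : complex.Re (M u) = A + b * (1 - normc u ^+ 2) / normc (1 - u) ^+ 2.
  by rewrite /M !normc_sqr; case: (u) => x y /=; ring.
have M0 : M 0 = kap.
  rewrite /M subr0 divr1 addr0 mulr1 /b; case: (kap) => x y.
  by apply/eqP; rewrite eq_complex /=; apply/andP; split; apply/eqP; ring.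
have MA u : normc u < 1 -> A < complex.Re (M u).
  move=> u1; rewrite MRe ltrDl divr_gt0// ?exprn_gt0//; last first.
    by rewrite normc_gt0 subr_eq0; apply/eqP => uE; move: u1; rewrite -uE normc1 ltxx.
  by rewrite mulr_gt0// subr_gt0 expr_lt1// normc_ge0.
have neq0 u : A < complex.Re u -> u != 0.
  by move=> Au; apply/eqP => u0; move: Au; rewrite u0 ltNge A0.
have bound1 (N : nat) u : A < complex.Re u ->
    normc (m (Q u) * cexp (N%:R%:C * u)) <= expR (N%:R * complex.Re u).
  move=> Au; rewrite normcM normc_cexp.
  have -> : complex.Re (N%:R%:C * u) = N%:R * complex.Re u.
    by case: (u) => x y /=; rewrite mul0r subr0.
  rewrite ler_piMl ?expR_ge0//.
  by apply: le_trans (bm _ (QB _ Au)) (decay_le1 _).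
have bound2 (N : nat) u : A < complex.Re u ->
    normc (m (Q u) * cexp (N%:R%:C * u)) <= expR ((2 * W * N%:R) ^+ 3).
  move=> Au; rewrite normcM normc_cexp.
  have -> : complex.Re (N%:R%:C * u) = N%:R * complex.Re u.
    by case: (u) => x y /=; rewrite mul0r subr0.
  have nu : 0 < normc u by rewrite normc_gt0 neq0.
  have W2 : 0 < 2 * W by rewrite mulr_gt0.
  apply: le_trans (decay_expR_le (c := 2 * W * N%:R) (y := normc u / (2 * W)) _ _); last 2 first.
  - by rewrite mulr_ge0// ltW.
  - by rewrite divr_gt0.
  apply: ler_pM; [exact: normc_ge0|exact: expR_ge0|rewrite -Qdecay ?neq0//; exact/bm/QB|].
  rewrite ler_expR mulrAC mulrCA divff ?gt_eqF// mulr1 mulrC ler_wpM2r//.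
  exact: le_trans (ler_norm _) (Re_le_normc _).
pose rk k (l : R[i]) := (radius k)%:C * l.
have rk1 k l : normc l <= 1 -> normc (rk k l) < 1.
  move=> l1; rewrite normcM normcR ger0_norm ?radius_ge0//.
  by apply: le_lt_trans (radius_lt1 k); rewrite ler_piMr// radius_ge0.
have dM k l : normc l <= 1 -> differentiable (fun l => M (rk k l)) l.
  move=> l1; have did : differentiable (@id R[i]) l.
    by apply/derivable1_diffP; exact: derivable_id.
  have drk : differentiable (rk k) l.
    by apply: differentiableM; [exact: differentiable_cst|exact: did].
  apply: differentiableD; first exact: differentiable_cst.
  apply: differentiableM; first exact: differentiable_cst.
  apply: differentiableM.
    by apply: differentiableD; [exact: differentiable_cst|exact: drk].
  apply: differentiableV.
    by apply: differentiableB; [exact: differentiable_cst|exact: drk].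
  by rewrite subr_eq0; apply/eqP => uE; have := rk1 k l l1; rewrite -uE normc1 ltxx.
pose f N k (l : R[i]) := m (Q (M (rk k l))) * cexp (N%:R%:C * M (rk k l)).
have df N k l : normc l <= 1 -> differentiable (f N k) l.
  move=> l1; have dMl := dM k l l1; have Al := MA _ (rk1 k l l1).
  apply: differentiableM.
    apply: (@differentiable_comp _ _ _ _ (fun l => Q (M (rk k l))) m); last exact/dm/QB.
    apply: differentiableD; first exact: differentiable_cst.
    apply: differentiableZl; apply: differentiableM; first exact: differentiable_cst.
    by apply: differentiableV; [exact: dMl|exact: neq0].
  apply: (@differentiable_comp _ _ _ _ (fun l => N%:R%:C * M (rk k l)) cexp); last first.
    exact: differentiable_cexp.
  by apply: differentiableM; [exact: differentiable_cst|exact: dMl].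
have key (N : nat) : normc (m p) * expR (N%:R * complex.Re kap) <= expR (N%:R * A).
  apply: (@circle_limit_le R (f N) (expR ((2 * W * N%:R) ^+ 3)) _ _ (df N)).
  - by move=> k l l1; exact/bound2/MA/rk1.
  - apply: aeW => y yI e e0.
    (* the point 1 of the circle, where M has its pole, is y = 0 or y = 2 pi *)
    have cy : 1 - 1%:C * cis y != 0.
      rewrite mul1r subr_eq0; apply/eqP => /(congr1 (@complex.Re R)) /=.
      rewrite expR0 mul1r => cos1.
      have s0 : 0 < sin (y / 2) by apply: sin_gt0_pi; rewrite divr_gt0 /=; lra.
      have := cosD (y / 2) (y / 2); rewrite -splitr -cos1 -!expr2.
      by have := cos2Dsin2 (y / 2); nra.
    pose v (r : R) := expR (N%:R * (A + b * (1 - r ^+ 2) / normc (1 - r%:C * cis y) ^+ 2)).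
    have cv : {for 1, continuous v}.
      apply: (continuous_comp (f := fun r : R =>
        N%:R * (A + b * (1 - r ^+ 2) / normc (1 - r%:C * cis y) ^+ 2))); last exact: continuous_expR.
      apply: (@cvgM _ _ (nbhs (1 : R))); first exact: cvg_cst.
      apply: (@cvgD _ _ _ (nbhs (1 : R))); first exact: cvg_cst.
      apply: (@cvgM _ _ (nbhs (1 : R))).
        apply: (@cvgM _ _ (nbhs (1 : R))); first exact: cvg_cst.
        by apply: (@cvgB _ _ _ (nbhs (1 : R))); [exact: cvg_cst|exact: exprn_continuous].
      apply: (@cvgV _ _ (nbhs (1 : R))); first by rewrite sqrf_eq0 normc_eq0.
      apply: (continuous_comp (f := fun r : R => normc (1 - r%:C * cis y)) (g := fun t : R => t ^+ 2));
        last exact: exprn_continuous.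
      apply: (continuous_comp (f := fun r : R => 1 - r%:C * cis y) (g := @normc R));
        last exact: normc_continuous.
      apply/cvg_normcP => e' e'0; near=> r.
      rewrite opprD opprK addrACA subrr add0r addrC -mulrBl -rmorphB normcM.
      by rewrite normc_cis mulr1 normcR; near: r; apply: cvgr_dist_lt => //; exact: cvg_id.
    have v1 : v 1 = expR (N%:R * A) by rewrite /v expr1n subrr mulr0 mul0r addr0.
    have : (fun k => v (radius k)) @ \oo --> expR (N%:R * A).
      by rewrite -v1; exact: (cvg_comp radius v radius_cvg cv).
    move=> /cvgrPdist_lt/(_ e e0); apply: filterS => k; rewrite ltr_distlC => /andP[_ vk].
    apply: ltW; apply: le_lt_trans vk; apply: le_trans (bound1 _ _ (MA _ _)) _.
      by apply: rk1; rewrite normc_cis.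
    by rewrite MRe normcM normc_cis mulr1 normcR real_normK ?num_real.
  - have -> : (fun k => normc (f N k 0)) = fun=> normc (m p) * expR (N%:R * complex.Re kap).
      apply/funext => k; rewrite /f /rk mulr0 M0 normcM normc_cexp; congr (normc (m _) * expR _).
        by rewrite /Q divff// neq0//; rewrite -subr_gt0.
      by case: (kap) => x y /=; rewrite mul0r subr0.
    exact: cvg_cst.
apply/eqP; rewrite -normc_eq0; apply: contraT => mp.
have mp0 : 0 < normc (m p) by rewrite lt_def mp normc_ge0.
have key2 (N : nat) : normc (m p) * (N%:R * b) <= 1.
  have := key N; rewrite -ler_pdivlMr ?expR_gt0// -expRN -expRD.
  rewrite (_ : _ + _ = - (N%:R * b)); last by rewrite /b; ring.
  rewrite expRN -[X in _ <= X]mul1r ler_pdivlMr ?expR_gt0//.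
  by apply: le_trans; rewrite ler_pM2l//; have := expR_ge1Dx (N%:R * b); lra.
pose N := Num.trunc ((normc (m p) * b)^-1).
have := key2 N.+1; rewrite mulrCA -ler_pdivlMr ?mulr_gt0// div1r leNgt.
by rewrite Num.Theory.truncnS_gt.
Unshelve. all: by end_near. Qed.

End vanishing.

(** * Integrability of the logarithm *)

Section caps.
Context {R : realType} {n : nat}.
Notation sigma := (@surface_measure R n.+2).
Notation C := (borelC R n.+2).

Lemma open_measurable_borelC (U : set 'rV[R[i]]_n.+2) : open U -> measurable (U : set C).
Proof. exact: sub_sigma_algebra. Qed.

Lemma normc1B_continuous : continuous (fun c : R[i] => normc (1 - c)).
Proof.
move=> c; apply/(@cvgrPdist_lt _ _ _ (nbhs c)) => e e0; apply/nbhs_normcP; exists e => // c'.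
move=> cc; apply: le_lt_trans cc; rewrite ler_norml.
have E : (1 - c) - (1 - c') = c' - c by ring.
have := normc_lerB (1 - c) (1 - c'); have := normc_lerB (1 - c') (1 - c).
by rewrite (normc_dist (1 - c')) E; lra.
Qed.

Definition pole_dist (z : 'rV[R[i]]_n.+2) : R := normc (1 - z ord0 ord0).

Lemma pole_dist_continuous : continuous pole_dist.
Proof.
move=> z; apply: (continuous_comp (f := fun w : 'rV[R[i]]_n.+2 => w ord0 ord0)
  (g := fun c : R[i] => normc (1 - c))); first exact: coord_continuous.
exact: normc1B_continuous.
Qed.

Lemma measurable_csphere : measurable (@csphere R n.+2 : set C).
Proof.
rewrite (_ : @csphere R n.+2 = ~` ([set z | enorm z != 1] : set C)); last first.
  by apply/seteqP; split => z /=; [move=> ->; rewrite eqxx|move/negP/negPn/eqP].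
apply: measurableC; apply: open_measurable_borelC.
rewrite (_ : mkset _ = @enorm R n.+2 @^-1` [set x | x != 1])//.
by apply: open_comp => [z _|]; [exact: enorm_continuous|exact: open_neq].
Qed.

Definition cap (r : R) : set C := [set z | csphere z /\ pole_dist z <= r].

Lemma measurable_cap r : measurable (cap r).
Proof.
rewrite (_ : cap r = (@csphere R n.+2 : set C) `&` ~` ([set z | r < pole_dist z] : set C)).
  apply: measurableI; first exact: measurable_csphere.
  apply: measurableC; apply: open_measurable_borelC.
  rewrite (_ : mkset _ = pole_dist @^-1` [set x | r < x])//.
  by apply: open_comp => [z _|]; [exact: pole_dist_continuous|exact: open_gt].
apply/seteqP; split => z [zS zr]; split => //.
  by apply/negP; rewrite -leNgt.
by rewrite leNgt; apply/negP.
Qed.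

(** In a point [rho *: z] of the cone over the cap of size [2 s ^ 2], the
    imaginary part of the first coordinate is at most [2 s ^ 2], and the second
    coordinate is at most [2 s], because [rho^2 - Re(rho z_1)^2 <= 4 s^2]. *)
Lemma cap_cone (s : R) (a b : R * R) (t : n.-tuple (R * R)) : 0 < s ->
  cap (2 * s ^+ 2) (radial_proj (vec3 a b t : C)) -> cball (vec3 a b t) ->
  [/\ rect (0, 0) 1 (2 * s ^+ 2) a, square (0, 0) (2 * s) b &
      tbox [tuple (0, 0) | _ < n] 1 t].
Proof.
move=> s0 [zS zc] zB; have [ha hb ht] := cball_unit_box zB.
pose rho := enorm (vec3 a b t).
have rho0 : 0 < rho.
  rewrite lt_def enorm_ge0 andbT; apply/eqP => r0.
  move: zS; rewrite /csphere /= /radial_proj -/rho r0 invr0 scale0r => /esym/eqP.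
  by rewrite -(scale0r (0 : 'rV[R[i]]_n.+2)) enormZ normc0 mul0r oner_eq0.
have rho1 : rho < 1 by exact: zB.
have dist : normc (rho%:C - (a.1 +i* a.2)) <= 2 * s ^+ 2 * rho.
  move: zc; rewrite /pole_dist /radial_proj -/rho.
  have -> : ((rho^-1)%:C *: vec3 a b t) ord0 ord0 = (rho^-1)%:C * (a.1 +i* a.2).
    by rewrite mxE vec3_0.
  have -> : rho%:C - (a.1 +i* a.2) = rho%:C * (1 - (rho^-1)%:C * (a.1 +i* a.2)).
    by rewrite mulrBr mulr1 mulrA -rmorphM/= divff ?gt_eqF// mul1r.
  by move=> h; rewrite normcM normcR (gtr0_norm rho0) [leLHS]mulrC ler_pM2r.
have s20 : 0 < s ^+ 2 by rewrite exprn_gt0.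
have lt_rho x : x <= 2 * s ^+ 2 * rho -> x < 2 * s ^+ 2.
  move=> h; apply: le_lt_trans h _; rewrite -[ltRHS]mulr1 ltr_pM2l//.
  by rewrite mulr_gt0.
have a2 : `|a.2| < 2 * s ^+ 2.
  apply: lt_rho; apply: le_trans dist; apply: le_trans (Im_le_normc _).
  by rewrite /= sub0r normrN.
have a1 : rho - a.1 <= 2 * s ^+ 2 * rho.
  by apply: le_trans dist; apply: le_trans (Re_le_normc _); rewrite /= ler_norm.
have b2 : b.1 ^+ 2 + b.2 ^+ 2 < (2 * s) ^+ 2.
  rewrite exprMn.
  have := enorm_vec3 a b t; rewrite -/rho => rE.
  have t0 : 0 <= \sum_j ((tnth t j).1 ^+ 2 + (tnth t j).2 ^+ 2).
    by apply: sumr_ge0 => j _; rewrite addr_ge0// sqr_ge0.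
  have a20 := sqr_ge0 a.2.
  have a1rho : a.1 <= rho.
    by apply: le_trans (ler_norm _) _; have := normc_le_enorm (vec3 a b t) ord0;
      rewrite vec3_0; apply: le_trans; exact: (Re_le_normc (a.1 +i* a.2)).
  apply: (@le_lt_trans _ _ ((rho - a.1) * (rho + a.1))).
    by rewrite -subr_sqr rE; lra.
  move: (s ^+ 2) s20 a1 => q q0 a1.
  apply: (@le_lt_trans _ _ ((2 * q * rho) * (2 * rho))).
    apply: (@le_trans _ _ ((rho - a.1) * (2 * rho))).
      by apply: ler_wpM2l; [rewrite subr_ge0|lra].
    by apply: ler_wpM2r => //; rewrite mulr_ge0// ltW.
  have rr : rho * rho < 1 by rewrite mulr_ilt1// ltW.
  by rewrite (_ : _ * _ = 4 * q * (rho * rho)); [nra|ring].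
have lt2s x y : x ^+ 2 + y ^+ 2 < (2 * s) ^+ 2 -> `|x| < 2 * s.
  move=> h; have s2 : 0 <= 2 * s by rewrite mulr_ge0// ltW.
  rewrite -(ltr_pXn2r (ltn0Sn 1)) ?nnegrE// real_normK ?num_real//.
  by apply: le_lt_trans h; rewrite lerDl sqr_ge0.
split => //.
  by apply/rectP; rewrite !subr0; split => //; have /squareP[] := ha; rewrite subr0.
apply/squareP; rewrite !subr0; split; first exact: lt2s b2.
by apply: (lt2s _ b.1); rewrite addrC.
Qed.

(** The box of [cap_cone] has sides of order [s ^ 2], [s] and [s] in three real
    directions, and bounded sides in the others. *)
Lemma surface_cap_le : exists2 K : R, 0 <= K &
  forall s : R, 0 < s -> (sigma (cap (2 * s ^+ 2)) <= (K * s ^+ 4)%:E)%E.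
Proof.
exists ((cball_volume R n.+2)^-1 * (128 * (4 ^+ n))).
  by rewrite mulr_ge0 ?cball_volumeV_ge0// mulr_ge0.
move=> s s0; rewrite surface_measureE.
apply: (@le_trans _ _ ((cball_volume R n.+2)^-1%:E *
    ((4 * 1 * (2 * s ^+ 2))%:E * (((2 * (2 * s)) ^+ 2)%:E * (((2 * 1) ^+ 2) ^+ n)%:E)))%E).
  rewrite lee_wpmul2l ?lee_fin ?cball_volumeV_ge0//.
  rewrite -(@power_measure_tbox R n [tuple (0, 0) | _ < n])//.
  rewrite -(@lebesgue_measure2_square R (0, 0)) ?mulr_gt0//.
  rewrite -(@lebesgue_measure2_rect R (0, 0)) ?mulr_gt0 ?exprn_gt0//.
  apply: lebesgue_measureC_le.
  - apply: measurableI; last exact: measurable_cball.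
    rewrite -[X in measurable X]setTI; apply: measurable_radial_proj => //.
    exact: measurable_cap.
  - exact: measurable_rect.
  - exact: measurable_square.
  - exact: measurable_tbox.
  - by move=> a b t [h1 h2]; exact: cap_cone.
rewrite -!EFinM lee_fin le_eqVlt; apply/orP; left; apply/eqP.
have -> : (2 * 1) ^+ 2 = 4 :> R by ring.
by ring.
Qed.

End caps.

Section log_integral.
Context {R : realType} {n : nat}.
Notation sigma := (@surface_measure R n.+2).
Notation C := (borelC R n.+2).
Notation dist := (@pole_dist R n).
Notation S := (@csphere R n.+2 : set C).

Definition neglog (z : 'rV[R[i]]_n.+2) : \bar R := (- lne (decay (dist z))%:E)%E.

Lemma neglog_ge0 z : (0 <= neglog z)%E.
Proof. by rewrite /neglog oppe_ge0 lne_le0 lee_fin decay_le1. Qed.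

Lemma neglogE z : dist z != 0 ->
  neglog z = ((dist z * Num.sqrt (dist z))^-1)%:E.
Proof.
move=> z0; rewrite /neglog lne_EFin ?decay_gt0// /decay (negbTE z0) expRK.
by rewrite ger0_norm ?normc_ge0// EFinN oppeK.
Qed.

Lemma neglog_gt (x : R) z : (x%:E < neglog z)%E = (decay (dist z) < expR (- x)).
Proof.
rewrite /neglog; have := decay_ge0 (dist z); rewrite le_eqVlt => /predU1P[<-|d0].
  by rewrite le0_lneNy//= ltry expR_gt0.
by rewrite lne_EFin// -EFinN lte_fin ltrNr -[in RHS](lnK d0) ltr_expR.
Qed.

Lemma measurable_neglog : measurable_fun [set: C] (neglog : C -> \bar R).
Proof.
apply: (measurability _ (ErealGenOInfty.measurableE R)) => // _ [_ [x ->] <-].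
rewrite setTI; apply: open_measurable_borelC.
rewrite (_ : _ @^-1` _ = (fun z => decay (dist z)) @^-1` [set y | y < expR (- x)]); last first.
  by apply/seteqP; split => z; rewrite /= in_itv/= andbT neglog_gt.
apply: open_comp => [z _|]; last exact: open_lt.
apply: (continuous_comp (f := dist)); first exact: pole_dist_continuous.
exact: decay_continuous.
Qed.

(** On the shell between the caps of sizes [2 / 4 ^ k.+1] and [2 / 4 ^ k] the
    function is at most [8 ^ k.+1], while the cap has measure of order
    [16 ^ - k]. *)
Lemma neglog_le_series z : csphere z ->
  (neglog z <= \sum_(k <oo) (8 ^+ k.+1 * \1_(cap (2 * (2^-1 ^+ k) ^+ 2)) (z : C))%:E)%E.
Proof.
move=> zS; set s := (X in (_ <= X)%E).
have term_ge0 k : (0 <= (8 ^+ k.+1 * \1_(cap (2 * (2^-1 ^+ k) ^+ 2)) (z : C) : R)%:E)%E.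
  by rewrite lee_fin mulr_ge0// exprn_ge0.
have s_ge k : cap (2 * (2^-1 ^+ k) ^+ 2) (z : C) -> ((8 ^+ k.+1)%:E <= s)%E.
  move=> kz; apply: le_trans (nneseries_lim_ge k.+1 _); last first.
    by move=> j _ _; apply: term_ge0.
  rewrite big_nat_recr//= indicE mem_set// mulr1 leeDr//.
  by apply: sume_ge0 => j _; exact: term_ge0.
have z2 : dist z <= 2.
  rewrite /dist; apply: le_trans (normc_triangle _ _) _; rewrite normc1 normcNE.
  by have := normc_le_enorm z ord0; rewrite zS; lra.
have [z0|z0] := eqVneq (dist z) 0.
  apply: le_trans (leey _) _; rewrite leye_eq; apply/eqP/eqyP => r r0.
  apply: (@le_trans _ _ (8 ^+ (Num.trunc r).+1)%:E); last first.
    by apply: s_ge; split => //; rewrite /dist -/(dist z) z0 mulr_ge0// exprn_ge0.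
  rewrite lee_fin; apply: le_trans (ltW (truncnS_gt r)) _.
  by rewrite -natrX ler_nat ltnW// ltn_expl.
have d0 : 0 < dist z by rewrite lt_def z0 normc_ge0.
pose P k := 2 * (2^-1 ^+ k.+1) ^+ 2 < dist z.
have exP : exists k, P k.
  exists (Num.trunc (dist z)^-1); set k := Num.trunc _.
  have x0 : 0 < 2^-1 ^+ k.+1 :> R by rewrite exprn_gt0.
  have x1 : 2^-1 ^+ k.+1 <= 1 :> R by rewrite exprn_ile1// invf_le1// ler1n.
  rewrite /P; apply: (@le_lt_trans _ _ (2^-1 ^+ k)).
    rewrite [in leRHS](_ : 2^-1 ^+ k = 2 * 2^-1 ^+ k.+1); last by rewrite exprS; field.
    by rewrite ler_pM2l// expr2 ler_piMr// ltW.
  rewrite exprVn -[ltRHS]invrK ltf_pV2 ?posrE ?invr_gt0 ?exprn_gt0//.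
  apply: lt_le_trans (truncnS_gt _) _.
  by rewrite -natrX ler_nat ltn_expl.
have [k Pk kmin] := ex_minnP exP.
apply: (@le_trans _ _ (8 ^+ k.+1)%:E); last first.
  apply: s_ge; split => //; case: k Pk kmin => [|k] Pk kmin.
    by rewrite expr0 expr1n mulr1.
  rewrite leNgt; apply/negP => /kmin; by rewrite ltnn.
rewrite neglogE// lee_fin.
have x0 : 0 < 2^-1 ^+ k.+1 :> R by rewrite exprn_gt0.
have -> : 8 ^+ k.+1 = ((2^-1 ^+ k.+1) ^+ 3)^-1 :> R.
  by rewrite -exprM mulnC exprM -exprVn; congr (_ ^+ _); field.
move: Pk; rewrite /P; move: (2^-1 ^+ k.+1) x0 => x x0 xd.
have xd2 : x ^+ 2 <= dist z by apply: le_trans (ltW xd); have := sqr_ge0 x; lra.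
have xs : x <= Num.sqrt (dist z).
  by rewrite -[leLHS]gtr0_norm// -sqrtr_sqr ler_wsqrtr.
rewrite lef_pV2 ?posrE ?exprn_gt0// ?mulr_gt0// ?sqrtr_gt0//.
by rewrite exprSr; apply: ler_pM => //; [exact: sqr_ge0|exact: ltW].
Qed.

Lemma neglog_integral : (\int[sigma]_(z in S) neglog z < +oo)%E.
Proof.
have [K K0 capK] := @surface_cap_le R n.
pose A k : set C := cap (2 * (2^-1 ^+ k) ^+ 2).
have mA k : measurable (A k) by exact: measurable_cap.
have mS := @measurable_csphere R n.
have mf k : measurable_fun S (fun z : C => (8 ^+ k.+1 * \1_(A k) z)%:E : \bar R).
  by apply/measurable_EFinP; apply: measurable_funM => //; exact: measurable_indic.
apply: (@le_lt_trans _ _ (\int[sigma]_(z in S) \sum_(k <oo) (8 ^+ k.+1 * \1_(A k) z)%:E)%E).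
  apply: ge0_le_integral => //.
  - by move=> z _; exact: neglog_ge0.
  - exact: measurable_funTS measurable_neglog.
  - by apply: ge0_emeasurable_sum => // k z _ _; rewrite lee_fin mulr_ge0.
  - exact: neglog_le_series.
rewrite integral_nneseries//.
apply: (@le_lt_trans _ _ (\sum_(k <oo) ((16 * K) / (2 ^ k.+1)%:R)%:E)%E); last first.
  by apply: le_lt_trans (epsilon_trick0 _ _) (ltry _); rewrite mulr_ge0.
apply: lee_nneseries => [k _ _|k _]; first by apply: integral_ge0 => z _; rewrite lee_fin mulr_ge0.
rewrite (integralZl_indic mS (fun=> A k))//; last by rewrite ltNge exprn_ge0.
rewrite integral_indic//.
have le1 : (sigma (A k `&` S) <= (K * (2^-1 ^+ k) ^+ 4)%:E)%E.
  have x0 : 0 < 2^-1 ^+ k :> R by rewrite exprn_gt0// invr_gt0.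
  apply: le_trans (capK _ x0).
  apply: le_measure; [rewrite inE; exact: measurableI|rewrite inE; exact: mA|].
  exact: subIsetl.
apply: (@le_trans _ _ ((8 ^+ k.+1)%:E * (K * (2^-1 ^+ k) ^+ 4)%:E)%E).
  by rewrite lee_wpmul2l// lee_fin exprn_ge0.
rewrite -EFinM lee_fin le_eqVlt; apply/orP; left; apply/eqP.
have h2 : 8 ^+ k * (2^-1 ^+ k) ^+ 4 = 2^-1 ^+ k :> R.
  by rewrite -exprM mulnC exprM -exprMn; congr (_ ^+ k); field.
have e1 : (2 ^+ k.+1)^-1 = 2^-1 * 2^-1 ^+ k :> R by rewrite -exprVn exprS.
rewrite natrX e1 (exprS 8).
transitivity (8 * K * (8 ^+ k * (2^-1 ^+ k) ^+ 4)); first by ring.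
by rewrite h2; field.
Qed.

End log_integral.

(** * The theorem *)

Unset Implicit Arguments.

Theorem theorem3p4 (R : realType) (d : nat) (hd : (2 <= d)%N) :
  exists g : 'rV[R[i]]_d -> R,
    [/\ {within @csphere R d, continuous g},
        forall z, csphere z -> 0 <= g z,
        forall z, csphere z -> (g z = 0 <-> z = e1 R d),
        (-oo < \int[@surface_measure R d]_(z in @csphere R d) lne (g z)%:E)%E
      & forall m mstar : 'rV[R[i]]_d -> R[i],
          Hinfty m -> boundary_function m mstar ->
          {ae @surface_measure R d, forall z, csphere z -> `|mstar z| <= (g z)%:C} ->
          forall z, cball z -> m z = 0].
Proof.
case: d hd => [|[|n]] // _; exists (fun z => decay (pole_dist z)); split.
- apply: continuous_subspaceT => z.
  apply: (continuous_comp (f := @pole_dist R n)); first exact: pole_dist_continuous.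
  exact: decay_continuous.
- by move=> z _; exact: decay_ge0.
- move=> z zS; split=> [/decay_eq0 z0|->]; last first.
    by rewrite /pole_dist mxE eqxx subrr normc0 decay0.
  have z00 : z ord0 ord0 = 1.
    by apply/esym/eqP; rewrite -subr_eq0 -normc_eq0; apply/eqP.
  have := enorm_sqr z; rewrite zS expr1n big_ord_recl z00 normc1 expr1n.
  move=> /esym/eqP; rewrite -subr_eq0 addrC addrA addNr add0r.
  rewrite psumr_eq0 => [/allP zj|j _]; last exact: sqr_ge0.
  apply/rowP => j; rewrite mxE; case: (unliftP ord0 j) => [k ->|->] //=.
  by have := zj k (mem_index_enum _); rewrite sqrf_eq0 normc_eq0 => /eqP.
- have -> : (\int[@surface_measure R n.+2]_(z in @csphere R n.+2) lne (decay (pole_dist z))%:E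
      = - \int[@surface_measure R n.+2]_(z in @csphere R n.+2) neglog z)%E.
    rewrite -integral_ge0N => [|z _]; last exact: neglog_ge0.
    by apply: eq_integral => z _; rewrite /neglog oppeK.
  by rewrite lteNr; exact: neglog_integral.
- move=> m mstar mH mb mg; have [dm _] := mH.
  apply: (decay_vanishing dm) => p pB.
  apply: (@boundary_bound_in_ball R n m mstar (fun c => decay (normc (1 - c)))) => //.
    move=> c; apply: (continuous_comp (f := fun c : R[i] => normc (1 - c))).
      exact: normc1B_continuous.
    exact: decay_continuous.
  by apply: ae_mono mg => z h /h; rewrite lecR.
Qed.
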